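(* In the Markov decision setting with risk-sensitive preferences described in the context (with $\theta<0$ and $\beta:\mathsf Z\to(0,\infty)$), suppose that: (A1) the correspondence $\Gamma:\mathsf X\to\mathsf A$ is compact-valued and continuous; (A2) the reward function $r$ is non-negative, bounded and continuous on $\mathsf G$; (A3) the map $a\mapsto\int v(H(y,a,z'),z')P(z,dz')$ is continuous on $\mathsf A$ for any $v\in bm\mathsf X$ and $(y,z)\in\mathsf X$; (C1) there are constants with $0<\underline r\le r\le\bar r$ on $\mathsf G$; (C2) the map $\bar H(y,z'):=\sup_{a\in\mathsf A}H(y,a,z')$ from $\mathsf X$ to $\mathsf Y$ is well-defined and measurable and, for any given $z'\in\mathsf Z$, order-preserving on $\mathsf Y$; (C3) the discount factor $\beta$ is bounded and Borel measurable; (C4) there exists an $n\in\mathbb N$ such that $\sup_{z\in\mathsf Z}\mathbb E^P_z\prod_{t=0}^{n-1}\beta(Z_t)<1$. Then the fundamental optimality properties hold for $(V_b,\mathbb T_{RS})$, and VFI, OPI and HPI all converge in $(V_b,\mathbb T_{RS})$.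
   Context: Setting. $\mathsf Y$ (endogenous states, also partially ordered) and $\mathsf Z$ (exogenous states) are topological spaces with Borel $\sigma$-algebras; $\mathsf X=\mathsf Y\times\mathsf Z$ with the product topology, its Borel $\sigma$-algebra being taken to be the product $\sigma$-algebra. The action space $\mathsf A$ is a separable metrizable space. $\Gamma$ is a nonempty-valued correspondence from $\mathsf X$ to $\mathsf A$, $\mathsf G=\{(x,a)\in\mathsf X\times\mathsf A:a\in\Gamma(x)\}$, $r:\mathsf G\to\mathbb R$ is a reward function, $P$ is a stochastic (probability) kernel on $\mathsf Z$, and $H:\mathsf Y\times\mathsf A\times\mathsf Z\to\mathsf Y$ is measurable (next endogenous state is $y'=H(y,a,z')$ with $z'\sim P(z,\cdot)$). $\theta<0$ is constant and $\beta:\mathsf Z\to(0,\infty)$. $\mathbb E^P_z$ is expectation for the Markov chain $(Z_t)$ with kernel $P$ and $Z_0=z$. $bm\mathsf X$ is the space of bounded Borel measurable real functions on $\mathsf X$ with the pointwise order $\le$, and $(bm\mathsf X)_+$ its nonnegative elements. Let $b\in(bm\mathsf X)_+$ be the unique fixed point in $(bm\mathsf X)_+$ of $(Sv)(x)=\bar r+\beta(z)\int v(\bar H(y,z'),z')P(z,dz')$, $x=(y,z)$ (it exists and is unique under the assumptions). Put $V_b=[0,b]=\{v\in bm\mathsf X:0\le v\le b\}$. $\Sigma$ is the set of feasible policies: Borel measurable $\sigma:\mathsf X\to\mathsf A$ with $\sigma(x)\in\Gamma(x)$ for all $x$. For $\sigma\in\Sigma$, $v\in V_b$, $x=(y,z)$,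 $$(T_\sigma v)(x)=r(x,\sigma(x))+\frac{\beta(z)}{\theta}\ln\Big[\int e^{\theta v(H(y,\sigma(x),z'),z')}P(z,dz')\Big],$$ and $\mathbb T_{RS}=\{T_\sigma:\sigma\in\Sigma\}$. Abstract dynamic programs. An abstract dynamic program (ADP) is a pair $(V,\mathbb T)$ where $V=(V,\preceq)$ is a poset and $\mathbb T=\{T_\sigma:\sigma\in\Sigma\}$ is a nonempty family of order preserving self-maps on $V$. Given $v\in V$, $\sigma\in\Sigma$ is $v$-greedy if $T_\tau v\preceq T_\sigma v$ for all $\tau\in\Sigma$. The Bellman operator is $Tv:=\bigvee_\sigma T_\sigma v$ whenever the supremum exists; $v\in V$ solves the Bellman equation if $Tv$ exists and $Tv=v$. $(V,\mathbb T)$ is well-posed if each $T_\sigma$ has a unique fixed point $v_\sigma$ in $V$, and regular if a $v$-greedy policy exists for every $v\in V$. When $(V,\mathbb T)$ is well-posed, $V_\Sigma:=\{v_\sigma:\sigma\in\Sigma\}$; $\sigma$ is optimal if $v_\sigma$ is a greatest element of $V_\Sigma$; and the value function is $v^*:=\bigvee V_\Sigma$ whenever the supremum exists. Bellman's principle of optimality holds if $(V,\mathbb T)$ is well-posed and $\{\sigma\in\Sigma:\sigma\text{ is optimal}\}=\{\sigma\in\Sigma:\sigma\text{ is }v^*\text{-greedy}\}$ (both sets understood as empty if $v^*$ does not exist). The fundamental optimality properties hold if $(V,\mathbb T)$ is a well-posed and regular ADP and: (B1) at least one optimal policy exists; (B2) $v^*$ is the unique solution to the Bellman equation in $V$; (B3)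 Bellman's principle of optimality holds. Algorithms. Write $v_n\uparrow v$ if $(v_n)$ is increasing with supremum $v$. Fix, for each $v\in V$, a choice of $v$-greedy policy $\sigma$. Set $Hv:=v_\sigma$ (Howard policy operator, not to be confused with the transition map $H$) and, for $m\in\mathbb N$, $m\ge1$, $W_mv:=T_\sigma^m v$, where $\sigma$ is the chosen $v$-greedy policy. Let $V_U=\{v\in V:v\preceq Tv\}$. VFI converges if $T^nv\uparrow v^*$ for all $v\in V_U$; OPI converges if $W_m^nv\uparrow v^*$ for all $v\in V_U$ (for each $m$); HPI converges if (for the Howard operator) $H^nv\uparrow v^*$ for all $v\in V_U$. *)

(* Defs.v *)
From HB Require Import structures.
From mathcomp Require Import all_boot all_order all_algebra.
From mathcomp Require Import all_classical all_reals all_analysis.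

Set Implicit Arguments.
Unset Strict Implicit.
Unset Printing Implicit Defensive.

Import Order.TTheory GRing.Theory Num.Theory.
Import numFieldNormedType.Exports.

Local Open Scope classical_set_scope.
Local Open Scope ring_scope.

(** The poset is the subset [V] of an ambient ordered type [E]; every order
    notion below (suprema, greatest elements, fixed points) is relative to [V].
    The policy set is the subset [Sig] of [S], and [T s] only matters for
    [s] in [Sig] and on [V]. *)
Section AbstractDynamicProgram.
Context {disp : Order.disp_t} {E : porderType disp} {S : Type}.
Variables (V : set E) (Sig : set S) (T : S -> E -> E).

Implicit Types (v w : E) (s : S).

Definition is_sup_in (B : set E) v : Prop :=
  [/\ V v, ubound B v & forall w, V w -> ubound B w -> (v <= w)%O].

Definition is_adp : Prop :=
  [/\ Sig !=set0,
      forall s, Sig s -> forall v, V v -> V (T s v)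
    & forall s, Sig s -> forall v w, V v -> V w -> (v <= w)%O ->
        (T s v <= T s w)%O].

Definition greedy v s : Prop :=
  Sig s /\ forall s', Sig s' -> (T s' v <= T s v)%O.

(** [is_bellman_image v w]: the supremum [Tv] exists and equals [w]. *)
Definition is_bellman_image v : E -> Prop :=
  is_sup_in [set T s v | s in Sig].

Definition solves_bellman v : Prop := V v /\ is_bellman_image v v.

Definition is_policy_value s v : Prop := V v /\ T s v = v.

Definition well_posed : Prop :=
  forall s, Sig s -> exists! v, is_policy_value s v.

Definition regular : Prop := forall v, V v -> exists s, greedy v s.

Definition policy_values : set E :=
  [set v | exists2 s, Sig s & is_policy_value s v].

Definition optimal s : Prop :=
  Sig s /\ exists2 v, is_policy_value s v & ubound policy_values v.

Definition is_value_function v : Prop := is_sup_in policy_values v.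

Definition bellman_principle : Prop :=
  well_posed /\
  [set s | optimal s] = [set s | exists2 v, is_value_function v & greedy v s].

Definition fundamental_optimality : Prop :=
  [/\ is_adp, well_posed & regular] /\
  [/\ exists s, optimal s,
      exists2 vstar, is_value_function vstar &
        forall v, solves_bellman v <-> v = vstar
    & bellman_principle].

(** The default value [v] of [xget] is only used when [Tv] does not exist. *)
Definition bellman v : E := xget v (is_bellman_image v).

Definition greedy_choice (sel : E -> S) : Prop :=
  forall v, V v -> greedy v (sel v).

(** The default value [v] of [xget] is only used when the chosen policy has no
    fixed point in [V]. *)
Definition howard (sel : E -> S) v : E := xget v (is_policy_value (sel v)).

Definition optimistic (sel : E -> S) (m : nat) v : E := iter m (T (sel v)) v.

Definition upward : set E :=
  [set v | V v /\ exists2 w, is_bellman_image v w & (v <= w)%O].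

Definition increases_to (u : nat -> E) v : Prop :=
  {homo u : m n / (m <= n)%N >-> (m <= n)%O} /\ is_sup_in (range u) v.

Definition iterates_converge (f : E -> E) : Prop :=
  exists2 vstar, is_value_function vstar &
    forall v, upward v -> increases_to (fun n => iter n f v) vstar.

Definition VFI_converges : Prop := iterates_converge bellman.

Definition OPI_converges : Prop :=
  forall sel, greedy_choice sel ->
  forall m, (1 <= m)%N -> iterates_converge (optimistic sel m).

Definition HPI_converges : Prop :=
  forall sel, greedy_choice sel -> iterates_converge (howard sel).

End AbstractDynamicProgram.

Notation borel T := (g_sigma_algebraType (@open T)).

Definition separable (T : topologicalType) : Prop :=
  exists2 D : set T, countable D & dense D.

Definition metrizable (R : realType) (T : topologicalType) : Prop :=
  exists dist : T -> T -> R,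
    [/\ forall x y, dist x y = 0 <-> x = y,
        forall x y, dist x y = dist y x,
        forall x y z, dist x z <= dist x y + dist y z
      & forall (x : T) (U : set T), nbhs x U <->
          exists2 e, 0 < e & [set y | dist x y < e] `<=` U].

Definition upper_hemicontinuous (S T : topologicalType) (G : S -> set T) :=
  forall x (U : set T), open U -> G x `<=` U ->
    \forall x' \near x, G x' `<=` U.

Definition lower_hemicontinuous (S T : topologicalType) (G : S -> set T) :=
  forall x (U : set T), open U -> G x `&` U !=set0 ->
    \forall x' \near x, G x' `&` U !=set0.

Definition continuous_correspondence (S T : topologicalType) (G : S -> set T) :=
  upper_hemicontinuous G /\ lower_hemicontinuous G.

(** Under each [Pr z], [(C_t)] is a Markov chain with transition kernel [P] and
    [C_0 = z]: the last condition says that [P (C_n) B] is a version of the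
    conditional probability of [C_(n+1) \in B] given [C_0, ..., C_n]. *)
Definition markov_chain (R : realType) (dZ dO : measure_display)
    (Z : measurableType dZ) (Omega : measurableType dO) (P : R.-pker Z ~> Z)
    (Pr : Z -> probability Omega R) (C : nat -> Omega -> Z) : Prop :=
  [/\ forall t, measurable_fun [set: Omega] (C t),
      forall z (B : set Z), measurable B -> Pr z (C 0%N @^-1` B) = \d_z B
    & forall z n (F : set Omega) (B : set Z),
        g_sigma_preimage (fun t : 'I_n.+1 => C t) F -> measurable B ->
        Pr z (F `&` C n.+1 @^-1` B) = (\int[Pr z]_(w in F) P (C n w) B)%E].

Section RiskSensitive.
Context {R : realType} {dispY : Order.disp_t}
  {Y : POrderedPointedTopological.type dispY} {Z A : ptopologicalType}.

(** Bounded Borel functions on [Y * Z]; the sigma-algebra is the product one,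
    which is assumed to be the Borel one wherever this is used. *)
Definition bm : set (Y * Z -> R) :=
  [set v : Y * Z -> R | measurable_fun [set: borel Y * borel Z] v /\ bounded_fun v].

Definition graph (Gamma : Y * Z -> set A) : set ((Y * Z) * A) :=
  [set xa | Gamma xa.1 xa.2].

Definition feasible (Gamma : Y * Z -> set A) : set (Y * Z -> A) :=
  [set s : Y * Z -> A |
     measurable_fun [set: borel Y * borel Z]
       (s : borel Y * borel Z -> borel A) /\
     forall x, Gamma x (s x)].

Definition upper_operator (beta : Z -> R) (P : R.-pker borel Z ~> borel Z)
    (Hbar : Y -> Z -> Y) (rhi : R) (v : Y * Z -> R) : Y * Z -> R :=
  fun x => rhi + beta x.2 * \int[P x.2]_z' v (Hbar x.1 z', z').

Definition order_interval (b : Y * Z -> R) : set (Y * Z -> R) :=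
  [set v | bm v /\ forall x, 0 <= v x <= b x].

Definition rs_operator (r : Y * Z -> A -> R) (beta : Z -> R) (theta : R)
    (P : R.-pker borel Z ~> borel Z) (H : Y -> A -> Z -> Y)
    (s : Y * Z -> A) (v : Y * Z -> R) : Y * Z -> R :=
  fun x => r x (s x) + beta x.2 / theta *
    ln (\int[P x.2]_z' expR (theta * v (H x.1 (s x) z', z'))).

End RiskSensitive.

(* Main.v *)
Require Import Defs.
From HB Require Import structures.
From mathcomp Require Import all_boot all_order all_algebra.
From mathcomp Require Import all_classical all_reals all_analysis.
From mathcomp Require Import measurable_realfun ring lra.

Set Implicit Arguments.
Unset Strict Implicit.
Unset Printing Implicit Defensive.

Import Order.TTheory GRing.Theory Num.Theory.
Import numFieldNormedType.Exports.

Local Open Scope classical_set_scope.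
Local Open Scope ring_scope.

(** The entropic certainty equivalent with [theta < 0] is concave (Jensen's
    inequality for [y |-> y ^ t]), so every [T_s] satisfies
    [T_s (t v) >= t T_s v + (1 - t) rlo >= t T_s v + (1 - t) eps b] on [[0, b]].
    As in Du's fixed point theorem, this forces
    [T^n b - T^n 0 <= (1 - eps)^n b] for monotone [T], and squeezing between
    these two sequences replaces the contraction argument, which is not
    available since [beta] may exceed 1. The Bellman operator is a pointwise
    maximum of the [T_s] and inherits the inequality, so the same squeeze gives
    the value function and the convergence of the three algorithms.

    Three facts are needed to get there. [T_s] maps [[0, b]] to itself because
    [b] is increasing in [y], which comes from iterating [b = S b] and from the
    discount condition, read through the Markov property. Greedy policies exist
    by a measurable maximum theorem: the argmax correspondence is compact-valued
    and measurably meets closed sets, and a measurable selection is the limit of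
    successive restrictions to balls of radius [1 / (n + 1)] around a dense
    sequence. Finally, only the reward is jointly continuous; the continuation
    value is merely measurable in the state and continuous in the action, so
    level sets of the sum are approximated by countably many rectangles. *)

(** * Monotone subhomogeneous operators on an order interval *)

Section SubhomogeneousOperator.
Context {R : realType} {X : Type}.
Variables (V : set (X -> R)) (b : X -> R) (eps : R).
Hypothesis V0 : V (fun=> 0).
Hypothesis Vb : V b.
Hypothesis V_bound : forall v, V v -> forall x, 0 <= v x <= b x.
Hypothesis V_scale : forall (t : R) v, 0 <= t <= 1 -> V v -> V (fun x => t * v x).
Hypothesis V_lim : forall u : nat -> X -> R, (forall n, V (u n)) ->
  (forall x, cvgn (u^~ x)) -> V (fun x => limn (u^~ x)).
Hypothesis eps_gt0 : 0 < eps.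
Hypothesis eps_lt1 : eps < 1.

Definition subhomogeneous (f : (X -> R) -> X -> R) : Prop :=
  forall (t : R) v x, 0 <= t <= 1 -> V v ->
    t * f v x + (1 - t) * (eps * b x) <= f (fun y => t * v y) x.

Definition monotone_on (f : (X -> R) -> X -> R) : Prop :=
  forall v w, V v -> V w -> (v <= w)%O -> (f v <= f w)%O.

(** * Fixed points of a single operator *)

Section OneOperator.
Variable f : (X -> R) -> X -> R.
Hypothesis fV : forall v, V v -> V (f v).
Hypothesis f_mono : monotone_on f.
Hypothesis f_sub : subhomogeneous f.

Lemma iter_self n v : V v -> V (iter n f v).
Proof. by move=> Vv; elim: n => //= n; exact: fV. Qed.

Lemma iter_mono n v w : V v -> V w -> (v <= w)%O ->
  (iter n f v <= iter n f w)%O.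
Proof.
by move=> Vv Vw vw; elim: n => //= n IH; apply: f_mono => //; exact: iter_self.
Qed.

Lemma iter_ge_bot n v : V v -> (iter n f (fun=> 0) <= iter n f v)%O.
Proof.
by move=> Vv; apply: iter_mono => //; apply/lefP => x; case/andP: (V_bound Vv x).
Qed.

Lemma iter_le_top n v : V v -> (iter n f v <= iter n f b)%O.
Proof.
by move=> Vv; apply: iter_mono => //; apply/lefP => x; case/andP: (V_bound Vv x).
Qed.

(* Subhomogeneity turns [t * w_n <= u_n] into
   [(t + (1 - t) * eps) * w_(n+1) <= u_(n+1)]. *)
Lemma iter_top_bot n x :
  (1 - (1 - eps) ^+ n) * iter n f b x <= iter n f (fun=> 0) x.
Proof.
elim: n x => [|n IH] x /=; first by rewrite expr0 subrr mul0r.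
set t := 1 - (1 - eps) ^+ n in IH *.
have [q0 q1] : 0 <= (1 - eps) ^+ n /\ (1 - eps) ^+ n <= 1.
  have e0 : 0 <= 1 - eps by rewrite subr_ge0 ltW.
  by split; [exact: exprn_ge0 | apply: exprn_ile1 => //; rewrite gerBl ltW].
have t01 : 0 <= t <= 1 by rewrite /t; lra.
have Vw := iter_self n Vb.
have Vu := iter_self n V0.
have tw : ((fun y => t * iter n f b y) <= iter n f (fun=> 0))%O.
  by apply/lefP => y; exact: IH.
have /lefP/(_ x) H1 := f_mono (V_scale t01 Vw) Vu tw.
apply: le_trans H1; apply: le_trans (f_sub x t01 Vw).
(* Since [f] maps into [[0, b]], the term [eps * b x] dominates [eps] times the next iterate from
   [b]. *)
have /andP[w0 wb] := V_bound (fV Vw) x.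
rewrite exprS.
have -> : (1 - (1 - eps) * (1 - eps) ^+ n) = t + (1 - t) * eps.
  by rewrite /t; ring.
rewrite mulrDl lerD2l -mulrA ler_wpM2l ?ler_wpM2l//; first lra.
exact: ltW.
Qed.

(** The two iterates differ by at most [(1 - eps) ^+ n * b x], which tends to 0, so only one value
    fits between the two sequences. The comparisons with fixed points below all go through this
    squeeze. *)
Lemma iter_squeeze x c d : (forall n, iter n f (fun=> 0) x <= c) ->
  (forall n, d <= iter n f b x) -> d <= c.
Proof.
move=> uc dw; rewrite -subr_le0.
have gap n : d - c <= (1 - eps) ^+ n * b x.
  have /andP[_ wb] := V_bound (iter_self n Vb) x.
  have q0 : 0 <= (1 - eps) ^+ n by rewrite exprn_ge0// subr_ge0 ltW.
  have := ler_wpM2l q0 wb; have := iter_top_bot n x.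
  have := uc n; have := dw n; rewrite mulrBl mul1r; lra.
have cv0 : (fun n => (1 - eps) ^+ n * b x) @ \oo --> (0 : R).
  rewrite -[X in _ --> X](mul0r (b x)); apply: cvgMl; apply: cvg_expr.
  by rewrite ger0_norm ?subr_ge0 ?ltW// gtrBl.
 rewrite -(cvg_lim _ cv0)//.
apply: limr_ge; first by apply/cvg_ex; exists 0.
by apply: nearW => n; exact: gap.
Qed.

(** A fixed point lies above all iterates from 0, and [v <= f v] puts [v] below all its own
    iterates, hence below those from [b]. *)
Lemma subhomogeneous_le_fix v q : V v -> V q -> (v <= f v)%O -> f q = q ->
  (v <= q)%O.
Proof.
move=> Vv Vq vfv fq; apply/lefP => x; apply: iter_squeeze => n.
- have -> : q = iter n f q by elim: n => //= n <-.
  by have /lefP := iter_ge_bot n Vq.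
- suff vn : (v <= iter n f v)%O.
    by apply: le_trans (lefP _ _ (iter_le_top n Vv) x); exact/lefP.
  elim: n => //= n IH; apply: le_trans vfv _.
  by apply: f_mono => //; exact: iter_self.
Qed.

Lemma subhomogeneous_fix_unique p q : V p -> V q -> f p = p -> f q = q -> p = q.
Proof.
move=> Vp Vq fp fq; apply/le_anti/andP; split.
  by apply: subhomogeneous_le_fix => //; rewrite fp.
by apply: subhomogeneous_le_fix => //; rewrite fq.
Qed.

(** This supplies leastness when [q] is shown to be the supremum of a sequence of iterates: those of
    any [v] dominate those of 0, while [q] lies below those of [b]. *)
Lemma subhomogeneous_fix_le_bound v q w : V v -> V q -> f q = q ->
  (forall n, (iter n f v <= w)%O) -> (q <= w)%O.
Proof.
move=> Vv Vq fq vw; apply/lefP => x; apply: iter_squeeze => n.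
  by apply: le_trans (lefP _ _ (vw n) x); have /lefP := iter_ge_bot n Vv.
have -> : q = iter n f q by elim: n => //= n <-.
by have /lefP := iter_le_top n Vq.
Qed.

(** The candidate [p] is the pointwise limit of the iterates from 0. Order continuity of [f] is
    replaced by the squeeze: both [p] and [f p] lie between the iterates from 0 and those from
    [b]. *)
Lemma subhomogeneous_fix_exists : exists2 p, V p & f p = p.
Proof.
pose u n := iter n f (fun=> 0).
have Vu n : V (u n) by exact: iter_self.
have u_nd n : (u n <= u n.+1)%O.
  by rewrite /u iterSr; apply: iter_mono => //; last apply/lefP => x;
     [exact: fV|case/andP: (V_bound (fV V0) x)].
have u_ndx x : nondecreasing_seq (u^~ x).
  by apply/nondecreasing_seqP => n; have /lefP := u_nd n.
have u_ub x : has_ubound (range (u^~ x)).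
  by exists (b x) => _ [n _ <-]; case/andP: (V_bound (Vu n) x).
have u_cv x : cvgn (u^~ x) by exact: nondecreasing_is_cvgn.
pose p x := limn (u^~ x).
have Vp : V p by exact: V_lim.
have up n : (u n <= p)%O.
  by apply/lefP => x; apply: (nondecreasing_cvgn_le (u_ndx x)).
have pw n : (p <= iter n f b)%O.
  apply/lefP => x; apply: limr_le => //; apply: nearW => m.
  have [mn|nm] := leP m n.
    apply: le_trans (lefP _ _ (iter_ge_bot n Vb) x).
    exact: u_ndx.
  have -> : m = (n + (m - n))%N by rewrite subnKC// ltnW.
  rewrite /u iterD; have /lefP := iter_le_top n (iter_self (m - n) V0).
  exact.
have fp_ge n : (u n <= f p)%O.
  case: n => [|n]; first by apply/lefP => x; case/andP: (V_bound (fV Vp) x).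
  by apply: f_mono.
have fp_le n : (f p <= iter n f b)%O.
  case: n => [|n]; first by apply/lefP => x; case/andP: (V_bound (fV Vp) x).
  by apply: f_mono; [|exact: (iter_self n Vb)|exact: pw].
exists p => //; apply/le_anti/andP; split; apply/lefP => x; apply: iter_squeeze => n.
- exact: (lefP _ _ (up n)).
- exact: (lefP _ _ (fp_le n)).
- exact: (lefP _ _ (fp_ge n)).
- exact: (lefP _ _ (pw n)).
Qed.

End OneOperator.

(** * Bellman operator, optimal policies and algorithms for a family of operators *)

Section Optimality.
Context {S : Type}.
Variables (Sig : set S) (T : S -> (X -> R) -> X -> R).
Hypothesis TV : forall s, Sig s -> forall v, V v -> V (T s v).
Hypothesis T_mono : forall s, Sig s -> monotone_on (T s).
Hypothesis T_sub : forall s, Sig s -> subhomogeneous (T s).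
Hypothesis T_reg : regular V Sig T.

Let is_image := is_bellman_image V Sig T.
Let bell := bellman V Sig T.

Lemma bellman_image_greedy v s : V v -> greedy Sig T v s ->
  is_image v (T s v).
Proof.
move=> Vv [Ss vs]; split; first exact: TV.
- by move=> _ [s' Ss' <-]; exact: vs.
- by move=> w _; apply; exists s.
Qed.

Lemma is_sup_in_unique (B : set (X -> R)) v w :
  is_sup_in V B v -> is_sup_in V B w -> v = w.
Proof.
by move=> [Vv vB lv] [Vw wB lw]; apply/le_anti; rewrite lv// lw.
Qed.

Lemma bellman_imageE v w : is_image v w -> bell v = w.
Proof.
move=> vw; rewrite /bell /bellman.
by case: xgetP => [z _ /is_sup_in_unique|/(_ w)//]; apply.
Qed.

Lemma bellman_greedy v s : V v -> greedy Sig T v s -> bell v = T s v.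
Proof. by move=> Vv vs; exact/bellman_imageE/bellman_image_greedy. Qed.

Lemma bellman_is_image v : V v -> is_image v (bell v).
Proof.
move=> Vv; have [s vs] := T_reg Vv.
by rewrite (bellman_greedy Vv vs); exact: bellman_image_greedy.
Qed.

Lemma bellman_ge v s : V v -> Sig s -> (T s v <= bell v)%O.
Proof. by move=> /bellman_is_image[_ ub _] Ss; apply: ub; exists s. Qed.

Lemma bellman_self v : V v -> V (bell v).
Proof. by case/bellman_is_image. Qed.

Lemma bellman_mono : monotone_on bell.
Proof.
move=> v w Vv Vw vw; have [s vs] := T_reg Vv.
rewrite (bellman_greedy Vv vs); case: (vs) => Ss _.
by apply: le_trans (bellman_ge Vw Ss); exact: T_mono.
Qed.

(** The policy greedy at [v] is still a candidate at [t * v], where the maximum can only be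
    larger. *)
Lemma bellman_sub : subhomogeneous bell.
Proof.
move=> t v x t01 Vv; have [s vs] := T_reg Vv; case: (vs) => Ss _.
rewrite (bellman_greedy Vv vs); apply: le_trans (T_sub Ss x t01 Vv) _.
by have /lefP := bellman_ge (V_scale t01 Vv) Ss.
Qed.

Lemma well_posedP : well_posed V Sig T.
Proof.
move=> s Ss.
have [p Vp fp] := subhomogeneous_fix_exists (TV Ss) (T_mono Ss) (T_sub Ss).
exists p; split => // q [Vq fq].
exact: (subhomogeneous_fix_unique (TV Ss) (T_mono Ss) (T_sub Ss)).
Qed.

Lemma policy_value_le s v w : Sig s -> V v -> is_policy_value V T s w ->
  (v <= T s v)%O -> (v <= w)%O.
Proof.
move=> Ss Vv [Vw fw] vT.
exact: (subhomogeneous_le_fix (TV Ss) (T_mono Ss) (T_sub Ss)).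
Qed.

Lemma upwardE v : upward V Sig T v <-> V v /\ (v <= bell v)%O.
Proof.
split; first by move=> [Vv [w /bellman_imageE <- vw]].
by move=> [Vv vb]; split => //; exists (bell v) => //; exact: bellman_is_image.
Qed.

Section ValueFunction.
Variable p : X -> R.
Hypothesis Vp : V p.
Hypothesis bp : bell p = p.

Lemma le_value v : V v -> (v <= bell v)%O -> (v <= p)%O.
Proof.
move=> Vv vb.
exact: (subhomogeneous_le_fix bellman_self bellman_mono bellman_sub).
Qed.

Lemma policy_values_le v : policy_values V Sig T v -> (v <= p)%O.
Proof.
move=> [s Ss [Vv fv]]; apply: le_value => //.
by rewrite -{1}fv; exact: bellman_ge.
Qed.

Lemma greedy_valueP s : greedy Sig T p s <-> Sig s /\ T s p = p.
Proof.
split.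
  by move=> ps; rewrite -(bellman_greedy Vp ps) bp; case: ps.
by move=> [Ss sp]; split=> // s' Ss'; rewrite sp -{2}bp; exact: bellman_ge.
Qed.

Lemma value_in : policy_values V Sig T p.
Proof. by have [s /greedy_valueP[Ss sp]] := T_reg Vp; exists s. Qed.

Lemma value_function : is_value_function V Sig T p.
Proof.
split=> // [v|w Vw wub]; [exact: policy_values_le|exact/wub/value_in].
Qed.

(** The value of an optimal policy dominates [p], which is itself a policy value, and is dominated
    by it. So optimality means [T s p = p], and this is greediness because [bell p = p]. *)
Lemma optimal_greedy s : optimal V Sig T s <-> greedy Sig T p s.
Proof.
rewrite greedy_valueP; split.
  move=> [Ss [v [Vv fv] ub]]; split => //.
  suff -> : p = v by [].
  apply/le_anti; rewrite ub; last exact: value_in.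
  by rewrite policy_values_le//; exists s.
by move=> [Ss sp]; split => //; exists p => // v; exact: policy_values_le.
Qed.

(** Common criterion for the three algorithms: a step that preserves [v <= bell v], does not
    decrease, and gains at least a Bellman step produces iterates trapped between the value iterates
    and [p]. *)
Lemma iterates_to_value (f : (X -> R) -> X -> R) :
  (forall v, V v -> (v <= bell v)%O ->
     [/\ V (f v), (v <= f v)%O, (bell v <= f v)%O & (f v <= bell (f v))%O]) ->
  iterates_converge V Sig T f.
Proof.
move=> fP; exists p; first exact: value_function.
move=> v /upwardE[Vv vb].
have it n : V (iter n f v) /\ (iter n f v <= bell (iter n f v))%O.
  by elim: n => //= n [Vn nb]; case: (fP _ Vn nb).
have ge n : (iter n bell v <= iter n f v)%O.
  elim: n => //= n IH; have [Vn nb] := it n.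
  have [_ _ + _] := fP _ Vn nb; apply: le_trans.
  by apply: bellman_mono => //; elim: {IH Vn nb} n => //= n; exact: bellman_self.
split.
  apply: homo_leq => [w|w1 w2 w3|n]; [exact: lexx|exact: le_trans|].
  by have [Vn nb] := it n; case: (fP _ Vn nb).
split=> // [_ [n _ <-]|w Vw wub]; first by have [Vn nb] := it n; exact: le_value.
apply: (subhomogeneous_fix_le_bound bellman_self bellman_mono bellman_sub Vv) => //.
by move=> n; apply: le_trans (ge n) _; apply: wub; exists n.
Qed.

End ValueFunction.

Theorem subhomogeneous_adp : Sig !=set0 ->
  [/\ fundamental_optimality V Sig T, VFI_converges V Sig T,
      OPI_converges V Sig T & HPI_converges V Sig T].
Proof.
move=> Sig0.
have [p Vp bp] := subhomogeneous_fix_exists bellman_self bellman_mono bellman_sub.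
split.
- split; first by split; [split| exact: well_posedP |].
  split.
  + by have [s ps] := T_reg Vp; exists s; exact/(optimal_greedy Vp bp).
  + exists p; first exact: (value_function Vp bp).
    move=> v; split.
      move=> [Vv /bellman_imageE bv].
      exact: (subhomogeneous_fix_unique bellman_self bellman_mono bellman_sub).
    move=> ->; split => //; have := bellman_is_image Vp; rewrite bp; exact.
  + split; first exact: well_posedP.
    apply/seteqP; split => s /=.
      move=> /(optimal_greedy Vp bp) ps; exists p => //; exact: (value_function Vp bp).
    move=> [v vf vs]; apply/(optimal_greedy Vp bp).
    by rewrite (is_sup_in_unique (value_function Vp bp) vf).
- apply: (iterates_to_value Vp bp) => v Vv vb; have Vbv := bellman_self Vv.
  by split => //; exact: bellman_mono.
- move=> sel selP m m1; apply: (iterates_to_value Vp bp) => v Vv vb.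
  have vs := selP _ Vv; case: (vs) => Ss _.
  rewrite (bellman_greedy Vv vs) in vb *.
  have Vi n : V (iter n (T (sel v)) v) by exact: (iter_self (TV Ss)).
  (* From [v <= T (sel v) v] the iterates under the fixed policy increase. With [m >= 1] they gain
     at least one Bellman step, and one further application stays below the Bellman image. *)
  have mono n : (iter n (T (sel v)) v <= iter n.+1 (T (sel v)) v)%O.
    elim: n => //= n IH; exact: (T_mono Ss (Vi n) (Vi n.+1) IH).
  have ge : (T (sel v) v <= iter m (T (sel v)) v)%O.
    case: m m1 => // m _; elim: m => // m IH; exact: le_trans IH (mono m.+1).
  split => //; first exact: Vi.
  + exact: le_trans vb ge.
  + exact: le_trans (mono m) (bellman_ge (Vi m) Ss).
- move=> sel selP; apply: (iterates_to_value Vp bp) => v Vv vb.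
  have vs := selP _ Vv; case: (vs) => Ss _.
  rewrite (bellman_greedy Vv vs) in vb *.
  have -> : howard V T sel v = xget v (is_policy_value V T (sel v)) by [].
  (* The chosen policy has a value in [V], so [xget] does not return its default here. *)
  have [w0 [pw0 _]] := well_posedP Ss.
  have := xgetPex v (ex_intro _ w0 pw0); move: (xget _ _) => w pw.
  (* With [w] the value of the chosen policy, [v <= w] gives [T v <= T w = w], so [w] gains at least
     a Bellman step; and [w = T w] lies below its own Bellman image. *)
  have vw := policy_value_le Ss Vv pw vb; case: pw => Vw fw.
  split => //.
  + by rewrite -fw; exact: T_mono.
  + by rewrite -{1}fw; exact: bellman_ge.
Qed.

End Optimality.
End SubhomogeneousOperator.

(** * Measurable selections *)

Section MetrizedSpace.
Context {R : realType} {A : ptopologicalType}.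
Variable dist : A -> A -> R.
Hypothesis dist_eq0 : forall x y, dist x y = 0 <-> x = y.
Hypothesis dist_sym : forall x y, dist x y = dist y x.
Hypothesis dist_triangle : forall x y z, dist x z <= dist x y + dist y z.
Hypothesis dist_nbhs : forall (x : A) (U : set A), nbhs x U <->
  exists2 e : R, 0 < e & [set y | dist x y < e] `<=` U.

Lemma dist_refl x : dist x x = 0.
Proof. exact/dist_eq0. Qed.

Lemma dist_ge0 x y : 0 <= dist x y.
Proof.
by have := dist_triangle x y x; rewrite dist_refl (dist_sym y x); lra.
Qed.

Lemma nbhs_dist_ball x (e : R) : 0 < e -> nbhs x [set y | dist x y < e].
Proof. by move=> e0; apply/dist_nbhs; exists e. Qed.

Lemma closed_dist_ball c (e : R) : closed [set y | dist c y <= e].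
Proof.
rewrite -[X in closed X]setCK; apply: open_closedC; rewrite openE => y /= /negP.
rewrite -ltNge => ey; apply/dist_nbhs; exists (dist c y - e).
  by rewrite subr_gt0.
move=> z /= yz; apply/negP; rewrite -ltNge.
by have := dist_triangle c z y; rewrite (dist_sym z y); lra.
Qed.

Lemma dist_hausdorff : hausdorff_space A.
Proof.
move=> p q pq; apply/dist_eq0/eqP; rewrite eq_le dist_ge0 andbT leNgt.
apply/negP => pq0; have e0 : 0 < dist p q / 2 by lra.
have [z [/= pz qz]] := pq _ _ (nbhs_dist_ball p e0) (nbhs_dist_ball q e0).
by have := dist_triangle p z q; rewrite (dist_sym z q); lra.
Qed.

Lemma separable_dense_seq : separable A ->
  exists D : nat -> A, forall a (e : R), 0 < e -> exists k, dist (D k) a < e.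
Proof.
move=> [D /pcard_surjP[g gD] dD]; exists g => a e e0.
have [y [ye Dy]] : [set y | dist a y < e]° `&` D !=set0.
  apply: dD; last exact: open_interior.
  by exists a; exact: nbhs_dist_ball.
have [k _ gk] := gD _ Dy.
by exists k; rewrite gk dist_sym; move/interior_subset : ye.
Qed.

Section MeasurableSelection.
Context {d} {X : measurableType d}.
Variable D : nat -> A.
Hypothesis D_dense : forall a (e : R), 0 < e -> exists k, dist (D k) a < e.

(** Measurability of a correspondence tested on closed sets, a form that survives intersection with
    closed balls. *)
Definition hit_measurable (K : X -> set A) :=
  forall F, closed F -> measurable [set x | K x `&` F !=set0].

Definition compact_correspondence (K : X -> set A) :=
  forall x, compact (K x) /\ K x !=set0.

(* [shrink e K x] keeps the part of [K x] in the closed [e]-ball around the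
   first [D k] whose ball meets [K x]. *)
Definition shrink (e : R) (K : X -> set A) (x : X) : set A :=
  [set a | K x a /\ exists k, [/\ dist (D k) a <= e,
    K x `&` [set a | dist (D k) a <= e] !=set0 &
    forall j, (j < k)%N -> ~ (K x `&` [set a | dist (D j) a <= e] !=set0)]].

Lemma shrinkE (e : R) K x : 0 < e -> K x !=set0 -> exists k,
  shrink e K x = K x `&` [set a | dist (D k) a <= e] /\ shrink e K x !=set0.
Proof.
move=> e0 [a Ka].
have ex : exists k, `[< K x `&` [set a | dist (D k) a <= e] !=set0 >].
  have [k ka] := D_dense a e0; exists k; apply/asboolP; exists a; split => //=.
  exact: ltW.
case: (ex_minnP ex) => k /asboolP kP kmin; exists k.
have E : shrink e K x = K x `&` [set a | dist (D k) a <= e].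
  apply/seteqP; split => [b [Kb [j [jb jP jmin]]]|b [Kb kb]]; split => //=.
    suff -> : k = j by [].
    apply/eqP; rewrite eqn_leq kmin; last exact/asboolP.
    by rewrite leqNgt; apply/negP => /jmin.
  exists k; split => // j jk jP.
  by have := kmin j (introT (asboolP _) jP); rewrite leqNgt jk.
by split => //; rewrite E.
Qed.

Lemma shrink_compact (e : R) K : 0 < e -> compact_correspondence K ->
  compact_correspondence (shrink e K).
Proof.
move=> e0 cK x; have [cKx K0] := cK x; have [k [-> ?]] := shrinkE e0 K0.
split => //; apply: (subclosed_compact _ cKx); last exact: subIsetl.
apply: closedI; last exact: closed_dist_ball.
exact: (compact_closed dist_hausdorff).
Qed.

(** Ball [k] is the one kept at [x] exactly when [K x] meets it and misses all earlier balls, which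
    splits the hitting set into countably many measurable pieces. *)
Lemma shrink_hit_measurable (e : R) K : hit_measurable K ->
  hit_measurable (shrink e K).
Proof.
move=> mK F cF.
pose B k := [set a | dist (D k) a <= e].
rewrite [X in measurable X](_ : _ = \bigcup_k
  ([set x | K x `&` (B k `&` F) !=set0] `\`
   \bigcup_(j in `I_k) [set x | K x `&` B j !=set0])).
  apply: bigcupT_measurable => k; apply: measurableD.
    by apply: mK; apply: closedI => //; exact: closed_dist_ball.
  by apply: bigcup_measurable => j _; apply: mK; exact: closed_dist_ball.
apply/seteqP; split => x.
  move=> [a [[Ka [k [ka kP kmin]]] Fa]]; exists k => //; split; first by exists a.
  by move=> [j /= jk]; exact: kmin.
move=> [k _ [[a [Ka [ka Fa]]] kmin]]; exists a; split => //; split => //.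
exists k; split => //; first by exists a.
by move=> j jk jP; apply: kmin; exists j.
Qed.

Lemma shrink_diam (e : R) K x a a' : 0 < e -> shrink e K x a -> shrink e K x a' ->
  dist a a' <= e + e.
Proof.
move=> e0 Ka; have [|k [E _]] := @shrinkE e K x e0; first by exists a; case: Ka.
move: Ka; rewrite E => -[_ /= ka] [_ /= ka'].
by apply: le_trans (dist_triangle _ (D k) _) _; rewrite dist_sym; lra.
Qed.

(** Finite intersection property for the decreasing compact sets [K n] cut by [F]: otherwise each
    point has a neighbourhood that eventually misses them, and compactness makes one index serve all
    points. *)
Lemma compact_nested_hit (K : nat -> set A) (F : set A) :
  (forall n, compact (K n)) -> (forall n, K n.+1 `<=` K n) -> closed F ->
  (forall n, K n `&` F !=set0) -> exists a, F a /\ forall n, K n a.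
Proof.
move=> cK ndK cF KF.
have K_le m n : (m <= n)%N -> K n `<=` K m.
  elim: n => [|n IH]; first by rewrite leqn0 => /eqP ->.
  by rewrite leq_eqVlt => /predU1P[->//|/IH H]; exact: subset_trans (H).
apply: contrapT => no.
have : near_covering (K 0%N) by exact/compact_near_coveringP.
move=> /(_ nat \oo (fun n a => ~ (K n `&` F) a) _) H.
have [] : \forall n \near \oo, K 0%N `<=` (fun a => ~ (K n `&` F) a).
  apply: H => a _.
  have [m ma] : exists m, ~ (K m `&` F) a.
    apply: contrapT => h; apply: no; exists a.
    have {}h m : (K m `&` F) a by apply: contrapT => ?; apply: h; exists m.
    by split => [|m]; [case: (h 0%N)|case: (h m)].
  have oc : open (~` (K m `&` F)).
    apply: closed_openC; apply: closedI => //.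
    exact: (compact_closed dist_hausdorff).
  exists (~` (K m `&` F), [set n | (m <= n)%N]) => /=.
    by split; [exact: open_nbhs_nbhs|exists m].
  by move=> [a' n] /= [ma' mn] [Kn Fa']; apply: ma'; split => //; exact: K_le Kn.
move=> n _ /(_ n (leqnn n)) h; have [a [Ka Fa]] := KF n.
by apply: (h a); [exact: K_le Ka|split].
Qed.

(** The stages [L n x] are nested, compact, and of diameter tending to 0, so they share exactly one
    point. That point is in a closed [F] iff every stage meets [F], which makes the preimage of [F]
    a countable intersection of measurable sets. *)
Lemma measurable_selection (K : X -> set A) :
  compact_correspondence K -> hit_measurable K ->
  exists s : X -> A, (forall x, K x (s x)) /\
    forall F, closed F -> measurable (s @^-1` F).
Proof.
move=> cK mK.
pose e n : R := n.+1%:R^-1.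
have e0 n : 0 < e n by rewrite invr_gt0.
pose L := fix L n := if n is m.+1 then shrink (e m) (L m) else K.
have cL n : compact_correspondence (L n).
  by elim: n => //= n IH; exact: shrink_compact.
have mL n : hit_measurable (L n).
  by elim: n => //= n IH; exact: shrink_hit_measurable.
have LL x n : L n.+1 x `<=` L n x by move=> a [].
have pick x : exists a, forall n, L n x a.
  have LT n : L n x `&` setT !=set0 by rewrite setIT; exact: (cL n x).2.
  have [a [_ La]] := @compact_nested_hit (L ^~ x) setT (fun n => (cL n x).1)
    (LL x) closedT LT.
  by exists a.
exists (fun x => xget point [set a | forall n, L n x a]).
have sP x : forall n, L n x (xget point [set a | forall n, L n x a]).
  by have [a aP] := pick x; case: xgetP => [y _ //|/(_ a)]; case.
split => [x|F cF]; first exact: (sP x 0%N).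
rewrite [X in measurable X](_ : _ = \bigcap_n [set x | L n x `&` F !=set0]).
  by apply: bigcapT_measurable => n; exact: mL.
apply/seteqP; split => x.
  by move=> /= Fs n _; exists (xget point [set a | forall n, L n x a]).
move=> hit; have [a [Fa La]] := @compact_nested_hit (L ^~ x) F
  (fun n => (cL n x).1) (LL x) cF (fun n => hit n I).
rewrite /preimage/=; suff <- : a = xget point [set a | forall n, L n x a] by [].
apply/dist_eq0/eqP; rewrite eq_le dist_ge0 andbT; apply/ler_addgt0Pl => eps eps0.
rewrite addr0.
have [n ne] : exists n, e n < eps / 2.
  have [n] := @ltr_add_invr R 0 (eps / 2) ltac:(lra); rewrite add0r => ?.
  by exists n.
have := shrink_diam (e0 n) (La n.+1) (sP x n.+1); move: (e0 n); lra.
Qed.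

(** * Measurable maximizers *)

Section MeasurableArgmax.
Variables (Gamma : X -> set A) (r g : X -> A -> R).
Hypothesis Gamma_compact : compact_correspondence Gamma.
Hypothesis r_cont : forall x, {within Gamma x, continuous (r x)}.
Hypothesis r_hit : forall p,
  hit_measurable (fun x => [set a | Gamma x a /\ p <= r x a]).
Hypothesis g_cont : forall x, continuous (g x).
Hypothesis g_meas : forall a, measurable_fun setT (g ^~ a).

Let q x a := r x a + g x a.

Lemma near_continuous (f : A -> R) a (e : R) : {for a, continuous f} -> 0 < e ->
  \forall y \near a, `|f a - f y| < e.
Proof. by move=> /cvgr_dist_lt fa e0; exact: fa. Qed.

(* If no point of the compact [Gamma x `&` F] reaches the level [c], then the
   gap is uniform, so that some [n] fails on the right-hand side. *)
Lemma argmax_level_setE (c : R) (F : set A) : closed F ->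
  [set x | [set a | Gamma x a /\ c <= q x a] `&` F !=set0] =
  \bigcap_n \bigcup_k \bigcup_(p : rat)
    ([set x | [set a | Gamma x a /\ ratr p <= r x a] `&`
              ([set a | dist (D k) a <= n.+1%:R^-1] `&` F) !=set0] `&`
     (g ^~ (D k) @^-1` `[c - ratr p - n.+1%:R^-1, +oo[)).
Proof.
move=> cF; apply/seteqP; split => x.
  move=> [a [[Ga ca] Fa]] n _; set e : R := n.+1%:R^-1.
  have e0 : 0 < e by rewrite invr_gt0.
  have e20 : 0 < e / 2 by lra.
  have /dist_nbhs[dl dl0 dlP] := near_continuous (@g_cont x a) e20.
  have m0 : 0 < Num.min dl e by rewrite lt_min dl0 e0.
  have [k] := D_dense a m0; rewrite lt_min => /andP[kdl ke].
  (* The slack [e] is split in two: one half for a rational below [r x a], the other for moving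
     [g x] from [a] to the nearby [D k]. *)
  have rx : r x a - e / 2 < r x a by lra.
  have [p] := rat_in_itvoo rx.
  rewrite in_itv/= => /andP[p1 p2].
  exists k => //; exists p => //; split.
    exists a; split; first by split => //; exact: ltW.
    by split => //=; exact: ltW.
  rewrite /preimage/= in_itv/= andbT.
  have /= := dlP (D k); rewrite dist_sym => /(_ kdl); rewrite ltr_norml.
  by move: ca; rewrite /q; lra.
move=> H; apply: contrapT => no.
have [cG _] := Gamma_compact x.
have nc : near_covering_within (Gamma x).
  exact/near_covering_withinP/compact_near_coveringP.
(* [P n a] contradicts the right-hand side at stage [n] when its witness is [a]; compactness will
   give one stage for all of [Gamma x]. *)
pose P (n : nat) a := F a -> forall d, dist d a <= n.+1%:R^-1 ->
  r x a + g x d < c - n.+1%:R^-1.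
have [N _] : \forall n \near \oo, Gamma x `<=` P n.
  apply: nc => a Ga.
  have [Fa|Fa] := pselect (F a); last first.
    exists (~` F, setT) => /=; last by move=> [a' n] /= [? _] _ ?.
    split; last exact: filterT.
    by apply: open_nbhs_nbhs; split => //; exact: closed_openC.
  have qa : q x a < c.
    by rewrite ltNge; apply/negP => ca; apply: no; exists a.
  (* One quarter of the gap covers the variation of [r], one that of [g], one the term [n.+1%:R^-1],
     and one is left over. *)
  pose eta := (c - q x a) / 4.
  have eta0 : 0 < eta by rewrite /eta; lra.
  have /dist_nbhs[dl dl0 dlP] := near_continuous (@g_cont x a) eta0.
  have rn : \forall a' \near a, Gamma x a' -> `|r x a - r x a'| < eta.
    move/subspace_continuousP: (@r_cont x) => /(_ a Ga) /cvgr_dist_lt.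
    by move=> /(_ _ eta0).
  have dl20 : 0 < Num.min (dl / 2) eta by rewrite lt_min eta0 andbT; lra.
  have [N] := @ltr_add_invr R 0 _ dl20; rewrite add0r lt_min => /andP[N1 N2].
  exists ([set a' | Gamma x a' -> `|r x a - r x a'| < eta] `&`
    [set a' | dist a a' < dl / 2], [set n | (N <= n)%N]) => /=.
    split; last by exists N.
    by apply: filterI => //; apply: nbhs_dist_ball; lra.
  move=> [a' n] /= [[ra' da'] Nn] Ga' Fa' y yn.
  have nN : n.+1%:R^-1 <= N.+1%:R^-1 :> R.
    by rewrite lef_pV2 ?posrE ?ltr0n// ler_nat.
  have /= : dist a y < dl.
    have := dist_triangle a a' y; rewrite (dist_sym a' y).
    by move: da' yn nN N1; move: (n.+1%:R^-1) (N.+1%:R^-1) => u1 u2; lra.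
  move=> /dlP /=; move: (ra' Ga'); rewrite !ltr_norml; move: N2 nN.
  by move: (N.+1%:R^-1) (n.+1%:R^-1) => u1 u2; rewrite /eta /q; lra.
move=> /(_ N (leqnn N)) GP.
have [k _ [p _ [[a [[Ga pa] [Da Fa]]]]]] := H N I.
rewrite /preimage/= in_itv/= andbT.
move=> gk; have := GP a Ga Fa (D k) Da; move: pa gk => /=.
by move: (N.+1%:R^-1) => u; lra.
Qed.

Lemma argmax_level_hit (c : R) :
  hit_measurable (fun x => [set a | Gamma x a /\ c <= q x a]).
Proof.
move=> F cF; rewrite argmax_level_setE//; apply: bigcapT_measurable => n.
apply: bigcupT_measurable => k; apply: bigcupT_measurable_rat => p.
apply: measurableI.
  by apply: r_hit; apply: closedI => //; exact: closed_dist_ball.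
by rewrite -[X in measurable X]setTI; exact: g_meas.
Qed.

Lemma q_cont x : {within Gamma x, continuous (q x)}.
Proof.
by move=> a; apply: cvgD; [exact: r_cont|exact: (continuous_subspaceT (@g_cont x))].
Qed.

Lemma argmax_exists x (F : set A) : closed F -> Gamma x `&` F !=set0 ->
  exists a, [/\ Gamma x a, F a & forall a', Gamma x a' -> F a' -> q x a' <= q x a].
Proof.
move=> cF GF0; have [cG _] := Gamma_compact x.
have cGF : compact (Gamma x `&` F).
  apply: (subclosed_compact _ cG); last exact: subIsetl.
  by apply: closedI => //; exact: (compact_closed dist_hausdorff).
have qGF : {within Gamma x `&` F, continuous (q x)}.
  by apply: continuous_subspaceW (q_cont (x := x)); exact: subIsetl.
have [a /set_mem[Ga Fa] aP] := compact_EVT_max GF0 cGF qGF.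
by exists a; split => // a' Ga' Fa'; apply: aP; exact: mem_set.
Qed.

(** The maximizers at [x] meet a closed [F] iff no rational level is reached by [q x] on [Gamma x]
    but not on its part in [F]; these level conditions are measurable. *)
Lemma measurable_argmax : exists s : X -> A,
  [/\ forall x, Gamma x (s x),
      forall F, closed F -> measurable (s @^-1` F) &
      forall x a, Gamma x a -> q x a <= q x (s x)].
Proof.
pose K x := [set a | Gamma x a /\ forall a', Gamma x a' -> q x a' <= q x a].
have K0 x : K x !=set0.
  have [_ [a0 Ga0]] := Gamma_compact x.
  have [|a [Ga _ aP]] := @argmax_exists x setT closedT; first by exists a0.
  by exists a; split => // a' Ga'; exact: aP.
have cK : compact_correspondence K.
  move=> x; split => //; have [cG _] := Gamma_compact x.
  have [a0 [Ga0 a0P]] := K0 x.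
  (* A near cover of the maximizers extends to [Gamma x]: by continuity a non-maximizer has a
     neighbourhood free of maximizers. *)
  apply/compact_near_coveringP/near_covering_withinP => I F P FF KP.
  have nc : near_covering_within (Gamma x).
    exact/near_covering_withinP/compact_near_coveringP.
  suff : \forall i \near F, Gamma x `<=` (fun a => K x a -> P i a).
    by apply: filterS => i GP a Ka; apply: GP => //; case: Ka.
  apply: nc => a Ga.
  have [Ka|Ka] := pselect (K x a).
    by have := KP a Ka; apply: filterS => -[a' i] /= h _; exact: h.
  have qa : q x a < q x a0.
    rewrite ltNge; apply/negP => qa; apply: Ka; split => // a' Ga'.
    by apply: le_trans (a0P _ Ga') qa.
  have qn : \forall a' \near a, Gamma x a' -> `|q x a - q x a'| < q x a0 - q x a.
    move/subspace_continuousP: (@q_cont x) => /(_ a Ga) /cvgr_dist_lt.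
    by apply; rewrite subr_gt0.
  exists ([set a' | Gamma x a' -> `|q x a - q x a'| < q x a0 - q x a], setT) => /=.
    by split => //; exact: filterT.
  move=> [a' i] /= [qa' _] Ga' [_ /(_ a0 Ga0)].
  by move: (qa' Ga'); rewrite ltr_norml; lra.
have [|s [Ks ms]] := measurable_selection cK.
  move=> F cF.
  rewrite [X in measurable X](_ : _ = ~` \bigcup_(c : rat)
    ([set x | [set a | Gamma x a /\ ratr c <= q x a] `&` setT !=set0] `\`
     [set x | [set a | Gamma x a /\ ratr c <= q x a] `&` F !=set0])).
    apply: measurableC; apply: bigcupT_measurable_rat => c.
    by apply: measurableD; apply: argmax_level_hit => //; exact: closedT.
  apply/seteqP; split => x.
    move=> [a [[Ga aP] Fa]] [c _ [[b [[Gb cb] _]]]]; apply; exists a; split => //.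
    by split => //; apply: le_trans cb _; exact: aP.
  move=> h; have [a0 [Ga0 a0P]] := K0 x.
  have {}h (c : rat) : ratr c < q x a0 -> exists a, [/\ Gamma x a, F a & ratr c <= q x a].
    move=> ca0; apply: contrapT => no; apply: h; exists c => //; split.
      by exists a0; split => //; split => //; exact: ltW.
    by move=> [a [[Ga ca] Fa]]; apply: no; exists a.
  (* Any rational below the maximum shows that [F] meets [Gamma x]. A second one, between the
     maximum over [F] and the full maximum, gives the contradiction. *)
  have q1 : q x a0 - 1 < q x a0 by lra.
  have [c1] := rat_in_itvoo q1.
  rewrite in_itv/= => /andP[_ /h[b [Gb Fb _]]].
  have [|a [Ga Fa aP]] := argmax_exists (x := x) cF; first by exists b.
  exists a; split => //; split => // a' Ga'; apply: le_trans (a0P _ Ga') _.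
  rewrite leNgt; apply/negP => qa.
  have [c2] := rat_in_itvoo qa; rewrite in_itv/= => /andP[qc /h[b' [Gb' Fb' cb']]].
  by have := aP _ Gb' Fb'; rewrite leNgt (lt_le_trans qc cb').
by exists s; split => // x; case: (Ks x).
Qed.

End MeasurableArgmax.

End MeasurableSelection.
End MetrizedSpace.

(** * Level sets of a jointly continuous reward *)

Section UpperHemicontinuous.
Context {R : realType} {S T : topologicalType}.
Variables (Gamma : S -> set T) (r : S -> T -> R).
Hypothesis r_cont : {within [set xa : S * T | Gamma xa.1 xa.2],
  continuous (fun xa : S * T => r xa.1 xa.2)}.

Lemma near_graph_continuous x a (e : R) : Gamma x a -> 0 < e ->
  exists U : set S * set T, [/\ nbhs x U.1, nbhs a U.2 &
    forall x' a', U.1 x' -> U.2 a' -> Gamma x' a' -> `|r x a - r x' a'| < e].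
Proof.
move=> Ga e0; move/subspace_continuousP: r_cont.
move=> /(_ (x, a) Ga) /cvgr_dist_lt /(_ _ e0) [[U V] /= [Ux Va] UV].
by exists (U, V); split => // x' a' Ux' Va' Ga'; exact: (UV (x', a')).
Qed.

(** If [x] is outside the set, each action in [Gamma x] has a product neighbourhood avoiding the
    level or [F]. Compactness gives a common neighbourhood of [x], and upper hemicontinuity keeps
    nearby [Gamma x'] among the actions so treated. *)
Lemma level_correspondence_closed (p : R) (F : set T) :
  upper_hemicontinuous Gamma -> (forall x, compact (Gamma x)) -> closed F ->
  closed [set x | [set a | Gamma x a /\ p <= r x a] `&` F !=set0].
Proof.
move=> uG cG cF; rewrite -[X in closed X]setCK; apply: open_closedC.
rewrite openE => x nx.
pose good U := [set a | forall x', U x' ->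
  ~ ([set a | Gamma x' a /\ p <= r x' a] `&` F) a].
have /compact_near_coveringP cov := cG x.
(* Letting [U] run over ever smaller neighbourhoods of [x] turns the choice of a common one into a
   near-covering statement. *)
have : \forall U \near powerset_filter_from (nbhs x),
    Gamma x `<=` (fun a => nbhs a (good U)).
  apply: cov => a Ga.
  have [V [U [Va Ux UV]]] : exists V U, [/\ nbhs a V, nbhs x U & V `<=` good U].
    have [Fa|Fa] := pselect (F a); last first.
      exists (~` F), setT; split => //; last by move=> a' Fa' x' _ [].
      - by apply: open_nbhs_nbhs; split => //; exact: closed_openC.
      - exact: filterT.
    have rp : 0 < p - r x a.
      rewrite subr_gt0 ltNge; apply/negP => pr; apply: nx; exists a; split => //.
    have [[U V] /= [Ux Va UV]] := near_graph_continuous Ga rp.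
    exists V, U; split => // a' Va' x' Ux' [[Ga' pr] _].
    by have := UV _ _ Ux' Va' Ga'; rewrite ltr_norml; lra.
  exists (V°, [set W | W `<=` U]) => /=.
    split; first by apply: open_nbhs_nbhs; split; [exact: open_interior|].
    exact: small_set_sub.
  move=> [a' W] /= [Va' WU]; apply: filterS (Va') => a'' Va'' x' Wx'.
  exact: UV (WU _ Wx').
move=> GU0; have [U0 [GU U0x]] := filter_ex (filterI GU0 (near_small_set _)).
have := uG x (good U0)° (@open_interior _ _) GU.
move=> GU'; rewrite /interior/=.
apply: filterS (filterI U0x GU') => x' /= [U0x' Gx'] [a [[Ga pa] Fa]].
by apply: (interior_subset (Gx' _ Ga) x' U0x').
Qed.

End UpperHemicontinuous.

(** * The entropic certainty equivalent *)

Lemma bounded_fun_le_norm {R : realType} {T : Type} (f : T -> R) :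
  bounded_fun f <-> exists M, forall x, `|f x| <= M.
Proof.
split=> [[M [_ fM]]|[M fM]].
  by exists (`|M| + 1) => x; apply: fM => //; rewrite (le_lt_trans (ler_norm _)) ?ltrDl.
exists M; split; first exact: num_real.
by move=> N MN x _; apply: le_trans (fM x) (ltW MN).
Qed.

Section EntropicRisk.
Context {d} {T : measurableType d} {R : realType}.
Variable mu : {measure set T -> \bar R}.
Hypothesis mu1 : mu [set: T] = 1%E.
Implicit Types f g : T -> R.

Definition bounded_measurable f : Prop :=
  measurable_fun [set: T] f /\ exists M, forall x, `|f x| <= M.

Lemma bounded_measurable_integrable f : bounded_measurable f ->
  mu.-integrable [set: T] (EFin \o f).
Proof.
move=> [mf /bounded_fun_le_norm bf]; apply: measurable_bounded_integrable => //.
by rewrite mu1 ltry.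
Qed.

Lemma EFin_Rintegral f : bounded_measurable f ->
  (\int[mu]_x f x)%:E = (\int[mu]_x (f x)%:E)%E.
Proof.
move=> /bounded_measurable_integrable intf.
by rewrite fineK//; exact: integrable_fin_num.
Qed.

Lemma bounded_measurable_expR (t : R) f : bounded_measurable f ->
  bounded_measurable (fun x => expR (t * f x)).
Proof.
move=> [mf [M fM]]; split.
  by apply: measurableT_comp => //; exact: measurable_funM.
exists (expR (`|t| * M)) => x; rewrite ger0_norm ?expR_ge0// ler_expR.
by apply: le_trans (ler_norm _) _; rewrite normrM ler_wpM2l.
Qed.

Lemma bounded_measurable_affine (c e : R) f : bounded_measurable f ->
  bounded_measurable (fun x => c + e * f x).
Proof.
move=> [mf [M fM]]; split.
  by apply: measurable_funD => //; exact: measurable_funM.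
exists (`|c| + `|e| * M) => x; apply: le_trans (ler_normD _ _) _.
by rewrite lerD2l normrM ler_wpM2l.
Qed.

Lemma Rintegral_affine (c e : R) f : bounded_measurable f ->
  \int[mu]_x (c + e * f x) = c + e * \int[mu]_x f x.
Proof.
move=> bf; have intf := bounded_measurable_integrable bf.
rewrite RintegralD//.
- by rewrite Rintegral_cst// mu1/= mulr1 RintegralZl.
- apply: (bounded_measurable_integrable (f := fun=> c)).
  by split; [exact: measurable_cst|exists `|c|].
- apply: (bounded_measurable_integrable (f := fun x => e * f x)).
  have := bounded_measurable_affine 0 e bf.
  by under eq_fun do rewrite add0r.
Qed.

Lemma Rintegral_mono f g : bounded_measurable f -> bounded_measurable g ->
  (forall x, f x <= g x) -> \int[mu]_x f x <= \int[mu]_x g x.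
Proof.
by move=> bf bg fg; apply: le_Rintegral => //; exact: bounded_measurable_integrable.
Qed.

Lemma Rintegral_expR_gt0 (t : R) f : bounded_measurable f ->
  0 < \int[mu]_x expR (t * f x).
Proof.
move=> bf; have [mf [M fM]] := bf.
apply: (@lt_le_trans _ _ (expR (- (`|t| * M)))); first exact: expR_gt0.
have -> : expR (- (`|t| * M)) = \int[mu]_x (expR (- (`|t| * M)) + 0 * f x).
  by rewrite Rintegral_affine// mul0r addr0.
apply: Rintegral_mono.
- exact: bounded_measurable_affine.
- exact: bounded_measurable_expR.
move=> x; rewrite mul0r addr0 ler_expR lerNl; apply: le_trans (ler_norm _) _.
by rewrite normrN normrM ler_wpM2l.
Qed.

(** Integrate the tangent line of [expR] at [m], the mean of [t * f]. *)
Lemma ln_Rintegral_expR_Jensen (t : R) f : bounded_measurable f ->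
  t * \int[mu]_x f x <= ln (\int[mu]_x expR (t * f x)).
Proof.
move=> bf; have I0 := Rintegral_expR_gt0 t bf.
rewrite -ler_expR lnK ?posrE//.
set m := t * \int[mu]_x f x.
have tangent x : expR m * (1 - m) + expR m * t * f x <= expR (t * f x).
  have := expR_ge1Dx (t * f x - m); rewrite -(ler_pM2l (expR_gt0 m)) -expRD.
  by rewrite [m + _]addrC subrK; lra.
have := Rintegral_mono (bounded_measurable_affine _ _ bf)
  (bounded_measurable_expR t bf) tangent.
by rewrite Rintegral_affine// -mulrA -/m; lra.
Qed.

(** The tangent at [t * y], evaluated at [y] and at 0 and weighted by [t] and [1 - t], has its
    linear terms cancel. *)
Lemma expR_convex_at0 (t y : R) : 0 <= t <= 1 ->
  expR (t * y) <= 1 - t + t * expR y.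
Proof.
move=> /andP[t0 t1].
have e0 := expR_gt0 (t * y).
have h1 : expR (t * y) * (1 + (1 - t) * y) <= expR y.
  have := expR_ge1Dx ((1 - t) * y); rewrite -(ler_pM2l e0) -expRD.
  by rewrite -mulrDl addrCA subrr addr0 mul1r.
have h2 : expR (t * y) * (1 - t * y) <= 1.
  have := expR_ge1Dx (- (t * y)); rewrite -(ler_pM2l e0) -expRD.
  by rewrite subrr expR0.
have t1' : 0 <= 1 - t by lra.
have := ler_wpM2l t0 h1; have := ler_wpM2l t1' h2; lra.
Qed.

(** Subtracting [ln I] from [t * f] normalizes the exponential mean to 1; convexity then bounds the
    mean of the [s]-th power by 1, and scaling back gives the factor [E], the [s]-th power of
    [I]. *)
Lemma ln_Rintegral_expR_scale (t s : R) f : bounded_measurable f ->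
  0 <= s <= 1 -> ln (\int[mu]_x expR (t * (s * f x))) <=
                 s * ln (\int[mu]_x expR (t * f x)).
Proof.
move=> bf s01; have I0 := Rintegral_expR_gt0 t bf.
set I := \int[mu]_x expR (t * f x) in I0 *.
have bsf : bounded_measurable (fun x => s * f x).
  by have := bounded_measurable_affine 0 s bf; under eq_fun do rewrite add0r.
rewrite -ler_expR lnK ?posrE ?Rintegral_expR_gt0//.
have eI : I^-1 = expR (- ln I) by rewrite expRN lnK ?posrE.
set E := expR (s * ln I).
have pt x : expR (t * (s * f x)) <=
    E * (1 - s) + E * s * I^-1 * expR (t * f x).
  have := expR_convex_at0 (t * f x - ln I) s01.
  rewrite -(ler_pM2l (expR_gt0 (s * ln I))) -expRD -/E.
  rewrite mulrBr (addrC (s * ln I)) subrK expRD -eI.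
  have -> : s * (t * f x) = t * (s * f x) by ring.
  lra.
have be := bounded_measurable_expR t bf.
have := Rintegral_mono (bounded_measurable_expR t bsf)
  (bounded_measurable_affine _ _ be) pt.
by rewrite Rintegral_affine// -/I -(mulrA (E * s)) mulVf ?gt_eqF//; lra.
Qed.

Lemma ln_Rintegral_expR_mono (t : R) f g : t < 0 ->
  bounded_measurable f -> bounded_measurable g -> (forall x, f x <= g x) ->
  ln (\int[mu]_x expR (t * g x)) <= ln (\int[mu]_x expR (t * f x)).
Proof.
move=> t0 bf bg fg; rewrite ler_ln ?posrE ?Rintegral_expR_gt0//.
apply: Rintegral_mono; [exact: bounded_measurable_expR..|].
by move=> x; rewrite ler_expR ler_wnM2l// ltW.
Qed.

End EntropicRisk.

(** * Expected discounts along a Markov chain *)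

Section IntegralLike.
Local Open Scope ereal_scope.
Context {d} {T : measurableType d} {R : realType}.
Implicit Types (f g : T -> \bar R) (I J : (T -> \bar R) -> \bar R).

Definition nonneg_measurable f : Prop :=
  measurable_fun [set: T] f /\ forall x, 0 <= f x.

(** These properties determine a functional on nonnegative measurable functions from its values on
    indicators, so identities between integrals need checking on sets only. *)
Definition integral_like I : Prop :=
  [/\ forall (c : R) f, (0 <= c)%R -> nonneg_measurable f ->
        I (fun x => c%:E * f x) = c%:E * I f,
      forall f g, nonneg_measurable f -> nonneg_measurable g ->
        I (fun x => f x + g x) = I f + I g
    & forall u : nat -> T -> \bar R, (forall n, nonneg_measurable (u n)) ->
        (forall x, nondecreasing_seq (u^~ x)) ->
        I (fun x => limn (u^~ x)) = limn (fun n => I (u n))].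

Import HBNNSimple.

Lemma nonneg_measurable_indic (B : set T) : measurable B ->
  nonneg_measurable (fun x => (\1_B x)%:E).
Proof. by move=> mB; split => //; exact/measurable_EFinP/measurable_indic. Qed.

Lemma nonneg_measurableZ (c : R) f : (0 <= c)%R -> nonneg_measurable f ->
  nonneg_measurable (fun x => c%:E * f x).
Proof.
by move=> c0 [mf f0]; split => [|x]; [exact: measurable_funeM|exact: mule_ge0].
Qed.

Lemma nonneg_measurableD f g : nonneg_measurable f -> nonneg_measurable g ->
  nonneg_measurable (fun x => f x + g x).
Proof.
by move=> [mf f0] [mg g0]; split => [|x]; [exact: emeasurable_funD|exact: adde_ge0].
Qed.

Lemma nonneg_measurableM f g : nonneg_measurable f -> nonneg_measurable g ->
  nonneg_measurable (fun x => f x * g x).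
Proof.
by move=> [mf f0] [mg g0]; split => [|x]; [exact: emeasurable_funM|exact: mule_ge0].
Qed.

Lemma integral_like_unique I J : integral_like I -> integral_like J ->
  (forall B, measurable B ->
     I (fun x => (\1_B x)%:E) = J (fun x => (\1_B x)%:E)) ->
  forall f, nonneg_measurable f -> I f = J f.
Proof.
move=> [IZ ID Il] [JZ JD Jl] IJ f [mf f0].
have IJ0 : I (fun=> 0) = J (fun=> 0).
  have := IJ set0 measurable0.
  by under eq_fun do rewrite indic0.
(* A simple function is a sum over its range. Allowing any list of nonnegative values lets the
   induction run, and measurability is carried along for additivity. *)
have IJs (h : {nnsfun T >-> R}) (s : seq R) : (forall r, r \in s -> 0 <= r)%R ->
    nonneg_measurable (fun x => (\sum_(r <- s) r * \1_(h @^-1` [set r]) x)%:E) /\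
    I (fun x => (\sum_(r <- s) r * \1_(h @^-1` [set r]) x)%R%:E) =
    J (fun x => (\sum_(r <- s) r * \1_(h @^-1` [set r]) x)%R%:E).
  elim: s => [_|r s IH s0].
    by under eq_fun do rewrite big_nil; split => //; split => //; exact: measurable_cst.
  have [|ns IJs] := IH; first by move=> r' r's; apply: s0; rewrite inE r's orbT.
  have r0 : (0 <= r)%R by apply: s0; rewrite mem_head.
  under eq_fun do rewrite big_cons EFinD EFinM.
  have nr := nonneg_measurable_indic (measurable_sfunP h (measurable_set1 r)).
  have nrc := nonneg_measurableZ r0 nr.
  split; first exact: nonneg_measurableD.
  by rewrite ID// JD// IJs IZ// JZ// IJ.
have IJn (h : {nnsfun T >-> R}) : nonneg_measurable (fun x => (h x)%:E) /\
    I (fun x => (h x)%:E) = J (fun x => (h x)%:E).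
  have -> : (fun x => (h x)%:E) =
    (fun x => (\sum_(r <- finmap.enum_fset (fset_set (range h)))
                 r * \1_(h @^-1` [set r]) x)%:E).
    by apply/funext => x; rewrite fimfunE fsbig_finite.
  apply: (IJs h (finmap.enum_fset (fset_set (range h)))) => r.
  by rewrite in_fset_set// inE => -[x _ <-]; exact: fun_ge0.
pose h_ := nnsfun_approx measurableT mf.
have -> : f = (fun x => limn (fun n => (h_ n x)%:E)).
  by apply/funext => x; apply/esym/cvg_lim => //; exact: cvg_nnsfun_approx.
have nd x : nondecreasing_seq (fun n => (h_ n x)%:E).
  by move=> m n mn; rewrite lee_fin; exact/lefP/nd_nnsfun_approx.
have nh n : nonneg_measurable (fun x => (h_ n x)%:E) by case: (IJn (h_ n)).
rewrite (Il _ nh nd) (Jl _ nh nd).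
suff -> : (fun n => I (fun x => (h_ n x)%:E)) = (fun n => J (fun x => (h_ n x)%:E)) by [].
by apply/funext => n; case: (IJn (h_ n)).
Qed.

Lemma integral_like_eval z : integral_like (fun f => f z).
Proof. by split. Qed.

End IntegralLike.

Lemma nonneg_measurable_comp d d' (T : measurableType d) (T' : measurableType d')
  (R : realType) (f : T' -> \bar R) (phi : T -> T') :
  measurable_fun [set: T] phi -> nonneg_measurable f ->
  nonneg_measurable (f \o phi).
Proof. by move=> mphi [mf f0]; split => [|x /=]; [exact: measurableT_comp|]. Qed.

Lemma integral_like_weighted d d' (T : measurableType d) (T' : measurableType d')
  (R : realType) (mu : {measure set T -> \bar R}) (u : T -> R) (phi : T -> T') :
  nonneg_measurable (EFin \o u) -> measurable_fun [set: T] phi ->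
  integral_like (fun f : T' -> \bar R => (\int[mu]_x ((u x)%:E * f (phi x)))%E).
Proof.
move=> nu mphi.
have nf (f : T' -> \bar R) : nonneg_measurable f ->
    nonneg_measurable (fun x => ((u x)%:E * f (phi x))%E).
  by move=> nf1; apply: nonneg_measurableM => //; exact: nonneg_measurable_comp nf1.
split => [c f c0 /nf[mf f0]|f g nf1 ng|v nv ndv].
- rewrite -ge0_integralZl_EFin//; apply: eq_integral => x _.
  by rewrite muleCA.
- have [[mf f0] [mg g0]] := (nf _ nf1, nf _ ng).
  rewrite -ge0_integralD//; apply: eq_integral => x _.
  by rewrite ge0_muleDr//; [case: nf1|case: ng].
- rewrite -monotone_convergence//.
  + apply: eq_integral => x _.
    have cv : cvgn (v^~ (phi x)) by exact: ereal_nondecreasing_is_cvgn.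
    by rewrite limeMl.
  + by move=> n; case: (nf _ (nv n)).
  + by move=> n x _; case: (nf _ (nv n)).
  + move=> x _ m n mn; apply: lee_wpmul2l; last exact: ndv.
    by case: nu => _ u0; exact: u0.
Qed.

(** * Markov property and discount iterates *)

Section MarkovChain.
Local Open Scope ereal_scope.
Context {R : realType} {dZ dO : measure_display} {Z : measurableType dZ}
  {Omega : measurableType dO}.
Variables (P : R.-pker Z ~> Z) (Pr : Z -> probability Omega R)
  (C : nat -> Omega -> Z) (beta : Z -> R).
Hypothesis C_chain : markov_chain P Pr C.
Hypothesis beta_ge0 : forall z, (0 <= beta z)%R.
Hypothesis beta_meas : measurable_fun [set: Z] beta.

Definition discount_operator (f : Z -> \bar R) : Z -> \bar R :=
  fun z => (beta z)%:E * \int[P z]_z' f z'.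

Let kint (f : Z -> \bar R) : Z -> \bar R := fun z => \int[P z]_z' f z'.

Let kint_nonneg f : nonneg_measurable f -> nonneg_measurable (kint f).
Proof.
move=> [mf f0]; split=> [|z]; last exact: integral_ge0.
apply: measurable_fun_integral_kernel => // U mU; exact: measurable_kernel.
Qed.

Let beta_nonneg : nonneg_measurable (EFin \o beta).
Proof. by split => [|z]; [exact/measurable_EFinP|rewrite lee_fin]. Qed.

Lemma discount_operator_nonneg f : nonneg_measurable f ->
  nonneg_measurable (discount_operator f).
Proof. by move=> nf; exact: nonneg_measurableM beta_nonneg (kint_nonneg nf). Qed.

Let integral_like_kint I : integral_like I -> integral_like (fun f => I (kint f)).
Proof.
move=> [IZ ID Il]; split => [c f c0 nf|f g nf ng|u nu ndu].
- rewrite -IZ//; last exact: kint_nonneg.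
  congr I; apply/funext => z; rewrite /kint ge0_integralZl_EFin//; first by case: nf.
  by case: nf.
- rewrite -ID; [|exact: kint_nonneg..].
  by congr I; apply/funext => z; case: nf => mf f0; case: ng => mg g0;
     rewrite /kint ge0_integralD.
- have nk n : nonneg_measurable (kint (u n)) by exact: kint_nonneg.
  have ndk z : nondecreasing_seq (fun n => kint (u n) z).
    move=> m n mn; apply: ge0_le_integral => //.
    + by move=> x _; case: (nu m).
    + by case: (nu m).
    + by case: (nu n).
    + by move=> x _; exact: ndu.
  rewrite -(Il _ nk ndk); congr I; apply/funext => z.
  rewrite /kint monotone_convergence//.
  + by move=> n; case: (nu n).
  + by move=> n x _; case: (nu n).
Qed.

(** The Markov property with a weight [W] that depends on the past: [Past] is [Omega] with the
    sigma-algebra generated by [C 0] to [C n]. The chain condition is the case of two indicators,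
    and [integral_like_unique] extends it first in the weight, then in [f]. *)
Lemma markov_chain_step z n (W : Omega -> R) (f : Z -> \bar R) :
  let Past := g_sigma_algebraType (\big[setU/set0]_(i < n.+1)
    preimage_set_system setT (C i) measurable) in
  measurable_fun [set: Past] (W : Past -> R) -> (forall w, (0 <= W w)%R) ->
  nonneg_measurable f ->
  \int[Pr z]_w ((W w)%:E * f (C n.+1 w)) =
  \int[Pr z]_w ((W w)%:E * \int[P (C n w)]_z' f z').
Proof.
move=> Past mW W0 nf; have [mC C0 Cstep] := C_chain.
have past_sub (F : set Omega) : measurable (F : set Past) -> measurable F.
  apply: smallest_sub; first exact: sigma_algebra_measurable.
  apply: (big_ind (fun G : set (set Omega) => G `<=` measurable)) => [|G1 G2 s1 s2|i _].
  - exact: sub0set.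
  - by rewrite subUset.
  - by move=> _ [B mB <-]; exact: mC.
have mid : measurable_fun [set: Omega] (id : Omega -> Past).
  by move=> _ F mF; rewrite setTI; exact: past_sub.
have mWO : measurable_fun [set: Omega] W by exact: (measurableT_comp mW mid).
have nW : nonneg_measurable (EFin \o (W : Omega -> R)).
  by split => [|w]; [exact/measurable_EFinP|rewrite lee_fin].
have nWp : nonneg_measurable (EFin \o (W : Past -> R)).
  by split => [|w]; [exact/measurable_EFinP|rewrite lee_fin].
(* Transition probabilities are finite, so they can serve as real weights in
   [integral_like_weighted]. *)
have fineP B w : measurable B -> (fine (P (C n w) B))%:E = P (C n w) B.
  move=> mB; rewrite fineK// ge0_fin_numE//.
  apply: (@le_lt_trans _ _ (P (C n w) setT)); first by apply: le_measure; rewrite ?inE.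
  by rewrite prob_kernel ltry.
have mP B : measurable B -> measurable_fun [set: Omega] (fun w => P (C n w) B).
  by move=> mB; apply: (measurableT_comp (measurable_kernel P B mB)); exact: mC.
have indicator_step B : measurable B -> forall W' : Past -> \bar R,
    nonneg_measurable W' ->
    \int[Pr z]_w ((\1_(C n.+1 @^-1` B) w)%:E * W' w) =
    \int[Pr z]_w ((fine (P (C n w) B))%:E * W' w).
  move=> mB; have mCB : measurable (C n.+1 @^-1` B).
    by rewrite -[X in measurable X]setTI; exact: mC.
  apply: integral_like_unique.
  - by apply: (integral_like_weighted _ _ mid); exact: nonneg_measurable_indic.
  - apply: (integral_like_weighted _ _ mid); split => [|w]; last by rewrite /= fineP.
    have -> : (EFin \o (fun w => fine (P (C n w) B))) = (fun w => P (C n w) B).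
      by apply/funext => w; exact: fineP.
    exact: mP.
  move=> F pF; have mF := past_sub _ pF.
  transitivity (\int[Pr z]_w (\1_(C n.+1 @^-1` B `&` F) w)%:E).
    by apply: eq_integral => w _; rewrite indicI.
  rewrite integral_indic//; last exact: (measurableI _ _ mCB mF).
  rewrite setIT setIC; apply: etrans (Cstep z n F B pF mB) _.
  rewrite integral_mkcond; apply: eq_integral => w _.
  rewrite patchE fineP// indicE; case: ifP => wF; first by rewrite mule1.
  by rewrite mule0.
move: f nf; apply: integral_like_unique.
- by apply: integral_like_weighted => //; exact: mC.
- apply: (@integral_like_kint (fun g => \int[Pr z]_w ((W w)%:E * g (C n w)))).
  by apply: integral_like_weighted => //; exact: mC.
move=> B mB; have := indicator_step B mB _ nWp.
under eq_integral do rewrite muleC; move=> ->.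
by apply: eq_integral => w _; rewrite muleC fineP// integral_indic// setIT.
Qed.

(** Induction removes the last transition: conditioning on the past replaces [f] at time [k.+1] by
    its kernel integral at time [k], and the last factor [beta] completes it to
    [discount_operator f]. *)
Lemma markov_chain_expectation z k (f : Z -> \bar R) : nonneg_measurable f ->
  \int[Pr z]_w ((\prod_(t < k) beta (C t w))%R%:E * f (C k w)) =
  iter k discount_operator f z.
Proof.
have [mC C0 _] := C_chain.
elim: k f => [|k IH] f nf.
  under eq_integral do rewrite big_ord0.
  move: f nf; apply: integral_like_unique.
  - apply: integral_like_weighted => //.
    by split => [|w]; [exact: measurable_cst|rewrite /= lee_fin].
  - exact: integral_like_eval.
  move=> B mB; under eq_integral do rewrite mul1e.
  rewrite (_ : (fun w => _) = EFin \o \1_(C 0%N @^-1` B))//.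
  rewrite integral_indic//; last by rewrite -[X in measurable X]setTI; exact: mC.
  by rewrite setIT; exact: etrans (C0 z B mB) _.
rewrite iterSr -IH; last exact: discount_operator_nonneg.
rewrite markov_chain_step//; last 2 first.
- apply: measurable_prod => t _; apply: measurableT_comp => //.
  move=> _ B mB; rewrite setTI; apply: sub_sigma_algebra.
  by rewrite (bigD1 t)//=; left; exists B => //; rewrite setTI.
- by move=> w; apply: prodr_ge0.
apply: eq_integral => w _; rewrite big_ord_recr/= EFinM -muleA.
by [].
Qed.

Lemma iter_discount_nonneg k (f : Z -> \bar R) : nonneg_measurable f ->
  nonneg_measurable (iter k discount_operator f).
Proof. by move=> nf; elim: k => //= k; exact: discount_operator_nonneg. Qed.

Lemma iter_discountZ k (c : R) (f : Z -> \bar R) : (0 <= c)%R ->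
  nonneg_measurable f ->
  iter k discount_operator (fun z => c%:E * f z) =
  (fun z => c%:E * iter k discount_operator f z).
Proof.
move=> c0 nf; elim: k => //= k ->; apply/funext => z.
have [mk k0] := iter_discount_nonneg k nf.
by rewrite /discount_operator ge0_integralZl_EFin// muleCA.
Qed.

Lemma discount_operator_le (f g : Z -> \bar R) : nonneg_measurable f ->
  nonneg_measurable g -> (forall z, f z <= g z) ->
  forall z, discount_operator f z <= discount_operator g z.
Proof.
move=> [mf f0] [mg g0] fg z; apply: lee_wpmul2l; first by rewrite lee_fin.
by apply: ge0_le_integral.
Qed.

Lemma iter_discount_le k (f g : Z -> \bar R) : nonneg_measurable f ->
  nonneg_measurable g -> (forall z, f z <= g z) ->
  forall z, iter k discount_operator f z <= iter k discount_operator g z.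
Proof.
move=> nf ng fg; elim: k => //= k IH z.
by apply: discount_operator_le => //; exact: iter_discount_nonneg.
Qed.

Lemma nonneg_measurable_cst (c : R) : (0 <= c)%R ->
  nonneg_measurable (fun _ : Z => c%:E).
Proof. by move=> c0; split => [|z]; [exact: measurable_cst|rewrite lee_fin]. Qed.

(** The bound [rho] on a block of [n] steps is uniform in the starting state, so monotonicity and
    homogeneity multiply it over [j] blocks. *)
Lemma iter_discount_geometric n :
  ereal_sup (range (fun z => 'E_(Pr z)[fun w => (\prod_(t < n) beta (C t w))%R])) < 1 ->
  exists2 rho : R, (0 <= rho < 1)%R &
    forall j z, iter (n * j) discount_operator (fun=> 1) z <= (rho ^+ j)%:E.
Proof.
set S := ereal_sup _ => S1.
have [rho rho01 Srho] : exists2 rho : R, (0 <= rho < 1)%R & S <= rho%:E.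
  case: S S1 => [r r1|//|_].
  (* The maximum with 0 makes [rho] nonnegative whatever the sign of the supremum. *)
  - rewrite lte_fin in r1; exists (Num.max r 0%R).
      by rewrite le_max lexx orbT/= gt_max r1 ltr01.
    by rewrite lee_fin le_max lexx.
  - by exists 0%R; rewrite ?lexx ?ltr01 ?leNye.
exists rho => //; case/andP: rho01 => rho0 rho1.
have n1 : nonneg_measurable (fun _ : Z => 1 : \bar R).
  exact: (nonneg_measurable_cst ler01).
have In z : iter n discount_operator (fun=> 1) z <= rho%:E.
  rewrite -markov_chain_expectation//; apply: le_trans Srho.
  apply: ereal_sup_ubound; exists z => //; rewrite unlock.
  by apply: eq_integral => w _; rewrite mule1.
elim=> [|j IH] z; first by rewrite muln0 expr0.
have rj0 : (0 <= rho ^+ j)%R by exact: exprn_ge0.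
have nrj := nonneg_measurableZ rj0 n1.
rewrite mulnS iterD.
apply: (@le_trans _ _ (iter n discount_operator (fun=> (rho ^+ j)%:E * 1) z)).
  apply: iter_discount_le => //; first exact: iter_discount_nonneg.
  by move=> z'; rewrite mule1.
by rewrite iter_discountZ// exprSr EFinM lee_wpmul2l.
Qed.

End MarkovChain.
(** * Risk-sensitive decision processes *)

Section KernelPrecomposition.
Context {d1 d2 d3} {X' : measurableType d1} {X : measurableType d2}
  {W : measurableType d3} {R : realType}.
Variables (k : R.-pker X ~> W) (f : X' -> X).
Hypothesis f_meas : measurable_fun [set: X'] f.

(** The measurability proof is an argument so that the kernel structures below can be attached to
    this term. *)
Definition kernel_precomp (mf : measurable_fun [set: X'] f) :
  X' -> {measure set W -> \bar R} := fun x => k (f x).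

Let kernel_precomp_meas U : measurable U ->
  measurable_fun [set: X'] (kernel_precomp f_meas ^~ U).
Proof. by move=> mU; exact: (measurableT_comp (measurable_kernel k U mU)). Qed.

HB.instance Definition _ :=
  isKernel.Build _ _ _ _ _ (kernel_precomp f_meas) kernel_precomp_meas.

Let kernel_precomp_prob x : kernel_precomp f_meas x [set: W] = 1%E.
Proof. exact: prob_kernel. Qed.

HB.instance Definition _ :=
  Kernel_isProbability.Build _ _ _ _ _ (kernel_precomp f_meas) kernel_precomp_prob.

Lemma measurable_Rintegral_precomp (h : X' * W -> R) :
  measurable_fun [set: X' * W] h -> (forall u, 0 <= h u) ->
  measurable_fun [set: X'] (fun x => \int[k (f x)]_w h (x, w)).
Proof.
move=> mh h0; apply: (measurableT_comp (fine_measurable measurableT)).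
apply: (measurable_fun_integral_finite_kernel (EFin \o h) (kernel_precomp f_meas)).
  by move=> u; rewrite /= lee_fin.
exact/measurable_EFinP.
Qed.

End KernelPrecomposition.

(** * The risk-sensitive operators on the order interval of [b] *)

Section RiskSensitiveProgram.
Context {R : realType} {dispY : Order.disp_t}
  {Y : POrderedPointedTopological.type dispY} {Z A : ptopologicalType}.
Hypothesis borel_prod : <<s @open (Y * Z)%type >> =
  (measurable : set (set (borel Y * borel Z))).
Hypotheses (A_sep : separable A) (A_metr : metrizable R A).
Variables (Gamma : Y * Z -> set A) (r : Y * Z -> A -> R)
  (P : R.-pker borel Z ~> borel Z) (H : Y -> A -> Z -> Y)
  (theta : R) (beta : Z -> R).
Hypothesis Gamma_neq0 : forall x, Gamma x !=set0.
Hypothesis H_meas : measurable_fun [set: borel Y * borel A * borel Z]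
  ((fun p => H p.1.1 p.1.2 p.2) : borel Y * borel A * borel Z -> borel Y).
Hypotheses (theta_lt0 : theta < 0) (beta_gt0 : forall z, 0 < beta z).
Hypothesis Gamma_compact : forall x, compact (Gamma x).
Hypothesis Gamma_uhc : upper_hemicontinuous Gamma.
Hypothesis r_cont :
  {within graph Gamma, continuous (fun xa => r xa.1 xa.2)}.
Hypothesis H_cont : forall v : Y * Z -> R, bm v -> forall (y : Y) (z : Z),
  continuous (fun a : A => \int[P z]_z' v (H y a z', z')).
Variables (rlo rhi : R).
Hypothesis rlo_gt0 : 0 < rlo.
Hypothesis r_bounds : forall x a, Gamma x a -> rlo <= r x a <= rhi.
Variables (Hbar : Y -> Z -> Y) (b : Y * Z -> R).
Hypothesis Hbar_lub : forall y z', isLub (range (fun a => H y a z')) (Hbar y z').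
Hypothesis Hbar_meas : measurable_fun [set: borel Y * borel Z]
  ((fun x => Hbar x.1 x.2) : borel Y * borel Z -> borel Y).
Hypothesis Hbar_mono : forall z' y1 y2, (y1 <= y2)%O ->
  (Hbar y1 z' <= Hbar y2 z')%O.
Hypothesis beta_meas : measurable_fun [set: borel Z] beta.
Hypotheses (b_bm : bm b) (b_ge0 : forall x, 0 <= b x).
Hypothesis b_fix : upper_operator beta P Hbar rhi b = b.

Let X : measurableType _ := (borel Y * borel Z)%type.
Let Vb := order_interval b.
Let Sig := feasible Gamma.
Let Trs := rs_operator r beta theta P H.

Let beta_ge0 z : 0 <= beta z. Proof. exact: ltW. Qed.

Let P1 z : P z [set: borel Z] = 1%E. Proof. exact: prob_kernel. Qed.

Lemma bmP (v : Y * Z -> R) : bm v <-> bounded_measurable (v : X -> R).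
Proof.
by split=> -[mv bv]; split => //; apply/(bounded_fun_le_norm v).
Qed.

Lemma bm_section (v : Y * Z -> R) (h : borel Z -> borel Y) : bm v ->
  measurable_fun [set: borel Z] h ->
  bounded_measurable (fun z' : borel Z => v (h z', z')).
Proof.
move=> /bmP[mv [M vM]] mh; split; last by exists M.
apply: (measurableT_comp mv); exact: measurable_fun_pair.
Qed.

Lemma transition_meas y a :
  measurable_fun [set: borel Z] (H y a : borel Z -> borel Y).
Proof.
apply: (measurableT_comp H_meas (g := fun z : borel Z =>
  ((y : borel Y, a : borel A), z))).
by apply: measurable_fun_pair => //; exact: measurable_cst.
Qed.

Lemma upper_transition_meas y :
  measurable_fun [set: borel Z] (Hbar y : borel Z -> borel Y).
Proof.
apply: (measurableT_comp Hbar_meas (g := fun z : borel Z => (y : borel Y, z))).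
by apply: measurable_fun_pair => //; exact: measurable_cst.
Qed.

Lemma Vb_bm v : Vb v -> bm v. Proof. by case. Qed.

Lemma b_bounded : exists2 M, 0 < M & forall x, b x <= M.
Proof.
have /bmP[_ [M bM]] := b_bm; exists (`|M| + 1) => [|x].
  by rewrite ltr_wpDl.
by have := bM x; have := ler_norm (b x); have := ler_norm M; lra.
Qed.

Lemma Vb0 : Vb (fun=> 0).
Proof.
split => [|x]; last by rewrite lexx b_ge0.
by apply/bmP; split; [exact: measurable_cst|exists 0 => x; rewrite normr0].
Qed.

Lemma Vb_top : Vb b. Proof. by split => // x; rewrite b_ge0 lexx. Qed.

Lemma Vb_bounded_bm (v : Y * Z -> R) : measurable_fun [set: X] (v : X -> R) ->
  (forall x, 0 <= v x <= b x) -> Vb v.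
Proof.
move=> mv vb; split => //; apply/bmP; split => //.
have [M _ bM] := b_bounded; exists M => x; have /andP[v0 vx] := vb x.
by rewrite ger0_norm// (le_trans vx).
Qed.

Lemma Vb_scale (t : R) v : 0 <= t <= 1 -> Vb v -> Vb (fun x => t * v x).
Proof.
move=> /andP[t0 t1] [/bmP[mv _] vb]; apply: Vb_bounded_bm.
  by apply: measurable_funM => //; exact: measurable_cst.
move=> x; have /andP[v0 vx] := vb x; rewrite mulr_ge0//=.
by apply: le_trans vx; rewrite ler_piMl.
Qed.

Lemma Vb_lim (u : nat -> Y * Z -> R) : (forall n, Vb (u n)) ->
  (forall x, cvgn (u^~ x)) -> Vb (fun x => limn (u^~ x)).
Proof.
move=> uV ucv; apply: Vb_bounded_bm.
  apply: (measurable_fun_cvg (h := (u : nat -> X -> R))) => [n|x _]; last exact: ucv.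
  by have [/bmP[]] := uV n.
move=> x; have ub n : 0 <= u n x <= b x by case: (uV n).
by rewrite limr_ge ?limr_le//; apply: nearW => n; case/andP: (ub n).
Qed.

(* Unrolling [b = Sb] [k] times bounds the defect of monotonicity of [b] by
   [M] times the [k]-step expected discount, which is small by assumption. *)
Lemma b_mono_defect M : 0 < M -> (forall x, b x <= M) ->
  forall k z y1 y2, (y1 <= y2)%O ->
  ((b (y1, z) - b (y2, z))%:E <=
   M%:E * iter k (discount_operator P (beta : borel Z -> R)) (fun=> 1) z)%E.
Proof.
move=> M0 bM; have n1 : nonneg_measurable (fun _ : borel Z => 1%E : \bar R).
  by split => [|z]; [exact: measurable_cst|rewrite lee_fin].
elim=> [|k IH] z y1 y2 y12 /=.
  by rewrite mule1 lee_fin; have := bM (y1, z); have := b_ge0 (y2, z); lra.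
have nk := iter_discount_nonneg P beta_ge0 beta_meas k n1.
set f := iter k _ _ in IH nk *.
have b1 := bm_section b_bm (upper_transition_meas y1).
have b2 := bm_section b_bm (upper_transition_meas y2).
have -> : b (y1, z) - b (y2, z) = beta z *
    \int[P z]_z' (b (Hbar y1 z', z') - b (Hbar y2 z', z')).
  rewrite RintegralB//; [|exact: (bounded_measurable_integrable (P1 z))..].
  by rewrite -[in LHS]b_fix /upper_operator/=; ring.
rewrite EFinM /discount_operator muleCA; apply: lee_wpmul2l.
  by rewrite lee_fin.
have [mf f0] := nk.
rewrite -ge0_integralZl_EFin//; last exact: ltW.
pose g z' := b (Hbar y1 z', z') - b (Hbar y2 z', z').
have mg : measurable_fun [set: borel Z] (g : borel Z -> R).
  by apply: measurable_funB; [case: b1|case: b2].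
have bg : bounded_measurable (g : borel Z -> R).
  split => //; exists M => z'; rewrite /g ler_norml.
  have := bM (Hbar y1 z', z'); have := bM (Hbar y2 z', z').
  by have := b_ge0 (Hbar y1 z', z'); have := b_ge0 (Hbar y2 z', z'); lra.
(* The induction hypothesis bounds [g] only from above; its positive part allows a comparison of
   nonnegative integrals. *)
have bg0 : bounded_measurable (fun z' : borel Z => Num.max (g z') 0).
  split; first by apply: measurable_maxr => //; exact: measurable_cst.
  have [_ [N gN]] := bg; exists N => z'; apply: le_trans (gN z').
  by rewrite /Num.max; case: ifP => // _; rewrite normr0.
apply: (@le_trans _ _ (\int[P z]_z' (Num.max (g z') 0)%:E)%E).
  rewrite -(EFin_Rintegral (P1 z) bg0) lee_fin.
  by apply: (Rintegral_mono (P1 z)) => // z'; rewrite le_max lexx.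
apply: ge0_le_integral => //.
- by move=> z' _; rewrite lee_fin le_max lexx orbT.
- by apply/measurable_EFinP; case: bg0.
- by apply: measurable_funeM.
move=> z' _; rewrite /Num.max; case: ifP => _.
  by rewrite mule_ge0// lee_fin ltW.
exact/IH/Hbar_mono.
Qed.

Lemma b_mono n (rho : R) : 0 <= rho < 1 ->
  (forall j z, (iter (n * j) (discount_operator P (beta : borel Z -> R))
                     (fun=> 1) z <= (rho ^+ j)%:E)%E) ->
  forall z y1 y2, (y1 <= y2)%O -> b (y1, z) <= b (y2, z).
Proof.
move=> rho01 rho_bound z y1 y2 y12; have [M M0 bM] := b_bounded; rewrite -subr_le0.
have gap j : b (y1, z) - b (y2, z) <= M * rho ^+ j.
  rewrite -lee_fin EFinM; apply: le_trans (b_mono_defect M0 bM (n * j) z y12) _.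
  by apply: lee_wpmul2l; [rewrite lee_fin ltW|exact: rho_bound].
have cv0 : (fun j => M * rho ^+ j) @ \oo --> (0 : R).
  rewrite -[X in _ --> X](mulr0 M); apply: cvgMr; apply: cvg_expr.
  by case/andP: rho01 => ? ?; rewrite ger0_norm.
rewrite -(cvg_lim _ cv0)//; apply: limr_ge; first by apply/cvg_ex; exists 0.
by apply: nearW => j; exact: gap.
Qed.

Lemma open_measurable (U : set (Y * Z)) : open U -> measurable (U : set X).
Proof. by move=> oU; rewrite -[measurable]borel_prod; exact: sub_sigma_algebra. Qed.

Lemma closed_measurable (F : set (Y * Z)) : closed F -> measurable (F : set X).
Proof.
move=> cF; rewrite -[F]setCK; apply: measurableC.
by apply: open_measurable; exact: closed_openC.
Qed.

Lemma measurable_fun_closed (s : X -> A) :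
  (forall F, closed F -> measurable (s @^-1` F)) <->
  measurable_fun [set: X] (s : X -> borel A).
Proof.
split=> [ms|ms F cF].
  apply: (@measurability _ _ _ (borel A) _ s (@open A) erefl) => _ [U oU <-].
  rewrite setTI -[U]setCK preimage_setC; apply: measurableC.
  exact: (ms _ (open_closedC oU)).
rewrite -[F]setCK preimage_setC; apply: measurableC.
rewrite -[X in measurable X]setTI.
by apply: (ms measurableT (~` F)); apply: sub_sigma_algebra; exact: closed_openC.
Qed.

(** By separability, [r x (s x) < p] holds iff [s x] is in some small ball around a dense point and,
    for all states near [x], feasible actions in that ball earn less than [p]. The second condition
    is open in [x]. *)
Lemma policy_reward_meas s : Sig s ->
  measurable_fun [set: X] (fun x : X => r x (s x)).
Proof.
move=> [/measurable_fun_closed ms Gs].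
have [dist [d0 dC dtri dnbhs]] := A_metr.
have [D D_dense] := separable_dense_seq dC dnbhs A_sep.
apply: (measurability _ (RGenInftyO.measurableE R)) => _ [_ [p ->] <-].
pose e m : R := m.+1%:R^-1.
pose B m k : set A := [set a | dist (D k) a <= e m].
pose U m k : set (Y * Z) := [set x | forall a, B m k a -> Gamma x a -> r x a < p].
rewrite setTI [X in measurable X](_ : _ =
    \bigcup_m \bigcup_k ((U m k)° `&` s @^-1` (B m k))).
  apply: bigcupT_measurable => m; apply: bigcupT_measurable => k.
  apply: measurableI; first by apply: open_measurable; exact: open_interior.
  by apply: ms; exact: closed_dist_ball.
apply/seteqP; split => x; rewrite /preimage/= ?in_itv/=; last first.
  by move=> [m _ [k _ [/interior_subset Ux Bx]]]; exact: Ux.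
move=> rp; have rp0 : 0 < p - r x (s x) by rewrite subr_gt0.
have [[V W] /= [Vx Ws VW]] := near_graph_continuous r_cont (Gs x) rp0.
have [dl dl0 dlW] := (dnbhs _ _).1 Ws.
have dl20 : 0 < dl / 2 by lra.
have [m] := @ltr_add_invr R 0 _ dl20; rewrite add0r -/(e m) => em.
have em0 : 0 < e m by rewrite invr_gt0.
have [k kx] := D_dense (s x) _ em0.
exists m => //; exists k => //; split; last exact: ltW.
apply: filterS Vx => x' Vx' a /= Ba Ga.
have Wa : W a.
  apply: dlW => /=; have := dtri (s x) (D k) a; rewrite (dC (s x) (D k)).
  by move: Ba em kx; rewrite /B/=; move: (e m) => u; lra.
by have := VW _ _ Vx' Wa Ga; rewrite ltr_norml; lra.
Qed.

Lemma policy_integral_meas (s : X -> borel A) (w : Y * Z -> R) :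
  measurable_fun [set: X] s -> bm w -> (forall x, 0 <= w x) ->
  measurable_fun [set: X]
    (fun x : X => \int[P x.2]_z' w (H x.1 (s x) z', z')).
Proof.
move=> ms /bmP[mw _] w0.
apply: (measurable_Rintegral_precomp P (f := snd) measurable_snd
  (h := fun xz : X * borel Z =>
  w (H xz.1.1 (s xz.1) xz.2, xz.2))) => //.
apply: (measurableT_comp mw); apply: measurable_fun_pair => //.
apply: (measurableT_comp H_meas (g := fun xz : X * borel Z =>
  ((xz.1.1, s xz.1), xz.2))).
apply: measurable_fun_pair => //; apply: measurable_fun_pair.
  exact: measurableT_comp.
exact: measurableT_comp.
Qed.

Lemma transition_section v y a : Vb v ->
  bounded_measurable (fun z' : borel Z => v (H y a z', z')).
Proof. by move=> [bv _]; exact: bm_section (transition_meas y a). Qed.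

Lemma expR_bm (v : Y * Z -> R) : bm v -> bm (fun x => expR (theta * v x)).
Proof. by move=> /bmP bv; exact/bmP/bounded_measurable_expR. Qed.

Lemma discount_theta_le0 z : beta z / theta <= 0.
Proof. by rewrite mulr_ge0_le0// invr_le0 ltW. Qed.

Lemma entropic_meas (s : X -> borel A) v : measurable_fun [set: X] s -> Vb v ->
  measurable_fun [set: X] (fun x : X => beta x.2 / theta *
    ln (\int[P x.2]_z' expR (theta * v (H x.1 (s x) z', z')))).
Proof.
move=> ms [bv _]; apply: measurable_funM.
  apply: measurable_funM; last exact: measurable_cst.
  exact: measurableT_comp.
apply: measurableT_comp => //.
exact: (policy_integral_meas ms (expR_bm bv) (fun x => expR_ge0 _)).
Qed.

Lemma Trs_mono s : Sig s -> monotone_on Vb (Trs s).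
Proof.
move=> _ v w Vv Vw /lefP vw; apply/lefP => x; rewrite /Trs /rs_operator lerD2l.
apply: ler_wnM2l; first exact: discount_theta_le0.
apply: (ln_Rintegral_expR_mono (P1 x.2)) => //.
- exact: (transition_section x.1 (s x) Vv).
- exact: (transition_section x.1 (s x) Vw).
Qed.

Lemma entropic0 (x : Y * Z) : ln (\int[P x.2]_z' expR (theta * 0)) = 0.
Proof. by rewrite mulr0 expR0 Rintegral_cst// P1/= mulr1 ln1. Qed.

Lemma reward_dominates_b : exists2 eps : R, 0 < eps < 1 &
  forall x, eps * b x <= rlo.
Proof.
(* The summand [rlo] in the denominator keeps [eps] strictly below 1. *)
have [M M0 bM] := b_bounded; exists (rlo / (rlo + M)).
  by rewrite divr_gt0 ?addr_gt0//= ltr_pdivrMr ?addr_gt0// mul1r ltrDl.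
move=> x; rewrite mulrAC ler_pdivrMr ?addr_gt0// ler_pM2l//.
by have := bM x; have := rlo_gt0; lra.
Qed.

(** The negative factor [beta / theta] reverses the scaling inequality for the logarithm, and the
    share [1 - t] of the reward is at least [(1 - t) * rlo]. *)
Lemma Trs_sub (eps : R) s : (forall x, eps * b x <= rlo) -> Sig s ->
  subhomogeneous Vb b eps (Trs s).
Proof.
move=> epsb [_ Gs] t v x t01 Vv; rewrite /Trs /rs_operator.
have := ln_Rintegral_expR_scale (P1 x.2) theta
  (transition_section x.1 (s x) Vv) t01.
move=> /(ler_wnM2l (discount_theta_le0 x.2)).
have /andP[rl _] := r_bounds (Gs x); case/andP: t01 => t0 t1.
have t1' : 0 <= 1 - t by lra.
have := ler_wpM2l t1' (le_trans (epsb x) rl).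
set L1 := ln _; set L2 := ln _; set q := beta _ / theta; set rx := r _ _.
by rewrite (mulrCA q t L1); lra.
Qed.

Section MonotoneBound.
Hypothesis b_increasing : forall z y1 y2, (y1 <= y2)%O -> b (y1, z) <= b (y2, z).

(** The lower bound compares [v] with 0, whose certainty equivalent is 0. For the upper bound,
    Jensen passes to the plain expectation, and [v <= b], [H <= Hbar] and monotonicity of [b] bound
    it by the one in [b = S b]. *)
Lemma Trs_self s : Sig s -> forall v, Vb v -> Vb (Trs s v).
Proof.
move=> Ss v Vv; have [ms Gs] := Ss; apply: Vb_bounded_bm.
  apply: measurable_funD; first exact: policy_reward_meas.
  exact: entropic_meas.
move=> x; have /andP[rl rh] := r_bounds (Gs x).
have bv := transition_section x.1 (s x) Vv.
have b0 := transition_section x.1 (s x) Vb0.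
have bb := bm_section b_bm (upper_transition_meas x.1).
have v0b z' : 0 <= v (H x.1 (s x) z', z') <= b (Hbar x.1 z', z').
  have [_ vb] := Vv; have /andP[-> vx] := vb (H x.1 (s x) z', z').
  apply: le_trans vx _; apply: b_increasing.
  by have [ub _] := Hbar_lub x.1 z'; apply: ub; exists (s x).
rewrite /Trs /rs_operator; apply/andP; split.
  apply: addr_ge0; first exact: le_trans (ltW rlo_gt0) rl.
  apply: mulr_le0; first exact: discount_theta_le0.
  rewrite -(entropic0 x).
  apply: (ln_Rintegral_expR_mono (P1 x.2) theta_lt0 b0 bv).
  by move=> z'; case/andP: (v0b z').
rewrite -[leRHS](congr1 (fun f => f x) b_fix) /upper_operator.
apply: lerD => //.
apply: (@le_trans _ _ (beta x.2 * \int[P x.2]_z' v (H x.1 (s x) z', z'))).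
  have := ln_Rintegral_expR_Jensen (P1 x.2) theta bv.
  move=> /(ler_wnM2l (discount_theta_le0 x.2)) /le_trans; apply.
  by rewrite mulrA divfK// lt_eqF.
apply: ler_wpM2l => //; apply: (Rintegral_mono (P1 x.2) bv bb).
by move=> z'; case/andP: (v0b z').
Qed.

(** A policy that maximizes the right-hand side at every state is greedy in the pointwise order, so
    a measurable argmax suffices. *)
Lemma Trs_regular : regular Vb Sig Trs.
Proof.
move=> v Vv; have [dist [d0 dC dtri dnbhs]] := A_metr.
have [D D_dense] := separable_dense_seq dC dnbhs A_sep.
pose g (x : X) a := beta x.2 / theta *
  ln (\int[P x.2]_z' expR (theta * v (H x.1 a z', z'))).
have [|||||s [Gs ms smax]] := @measurable_argmax R A dist d0 dC dtri dnbhs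
    _ X D D_dense Gamma r g.
- by move=> x; split; [exact: Gamma_compact|exact: Gamma_neq0].
- move=> x; apply/subspace_continuousP => a Ga; apply/cvgrPdist_lt => e e0.
  have [[U W] /= [Ux Wa UW]] := near_graph_continuous r_cont Ga e0.
  apply: filterS Wa => a' Wa' Ga'.
  exact: UW (nbhs_singleton Ux) Wa' Ga'.
- move=> p F cF; apply: closed_measurable.
  exact: (level_correspondence_closed r_cont).
(* The continuity hypothesis is applied to [expR (theta * v)], which is again bounded and Borel; the
   positive integral keeps [ln] continuous. Measurability in the state, in the next goal, is the
   case of a constant policy. *)
- move=> x a; apply: cvgMr; apply: continuous_cvg.
    apply: continuous_ln; apply: (Rintegral_expR_gt0 (P1 x.2)).
    exact: transition_section.
  exact: (H_cont (expR_bm (Vb_bm Vv))).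
- move=> a; apply: entropic_meas => //; exact: measurable_cst.
have Ss : Sig s by split => //; exact/measurable_fun_closed.
exists s; split => // s' [_ Gs']; apply/lefP => x; exact: (smax x (s' x) (Gs' x)).
Qed.

Lemma risk_sensitive_optimality :
  [/\ fundamental_optimality Vb Sig Trs, VFI_converges Vb Sig Trs,
      OPI_converges Vb Sig Trs & HPI_converges Vb Sig Trs].
Proof.
have [eps /andP[eps0 eps1] epsb] := reward_dominates_b.
apply: (subhomogeneous_adp Vb0 Vb_top _ Vb_scale Vb_lim eps0 eps1 Trs_self
  Trs_mono (fun s => Trs_sub epsb (s := s)) Trs_regular).
- by move=> v [].
- by have [s [Ss _]] := Trs_regular Vb0; exists s.
Qed.

End MonotoneBound.
End RiskSensitiveProgram.

Theorem proposition6p5 (R : realType) (dispY : Order.disp_t)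
  (Y : POrderedPointedTopological.type dispY) (Z A : ptopologicalType)
  (borel_prod : <<s @open (Y * Z)%type >> =
     (measurable : set (set (borel Y * borel Z))))
  (A_sep : separable A) (A_metr : metrizable R A)
  (Gamma : Y * Z -> set A) (Gamma_neq0 : forall x, Gamma x !=set0)
  (r : Y * Z -> A -> R)
  (P : R.-pker borel Z ~> borel Z)
  (H : Y -> A -> Z -> Y)
  (H_meas : measurable_fun [set: borel Y * borel A * borel Z]
     ((fun p => H p.1.1 p.1.2 p.2) :
        borel Y * borel A * borel Z -> borel Y))
  (theta : R) (theta_lt0 : theta < 0)
  (beta : Z -> R) (beta_gt0 : forall z, 0 < beta z)
  (* the Markov chain (C_t) with kernel P and its laws Pr z for C_0 = z *)
  (dO : measure_display) (Omega : measurableType dO)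
  (Pr : borel Z -> probability Omega R) (C : nat -> Omega -> borel Z)
  (C_chain : markov_chain P Pr C)
  (A1 : (forall x, compact (Gamma x)) /\ continuous_correspondence Gamma)
  (A2 : [/\ forall x a, Gamma x a -> 0 <= r x a,
            [bounded r xa.1 xa.2 | xa in graph Gamma]
          & {within graph Gamma, continuous (fun xa => r xa.1 xa.2)}])
  (A3 : forall v : Y * Z -> R, bm v -> forall (y : Y) (z : Z),
     continuous (fun a : A => \int[P z]_z' v (H y a z', z')))
  (rlo rhi : R) (rlo_gt0 : 0 < rlo)
  (C1 : forall x a, Gamma x a -> rlo <= r x a <= rhi)
  (Hbar : Y -> Z -> Y)
  (C2 : [/\ forall y z', isLub (range (fun a => H y a z')) (Hbar y z'),
            measurable_fun [set: borel Y * borel Z]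
              ((fun x => Hbar x.1 x.2) : borel Y * borel Z -> borel Y)
          & forall z' y1 y2, (y1 <= y2)%O -> (Hbar y1 z' <= Hbar y2 z')%O])
  (C3 : bounded_fun beta /\ measurable_fun [set: borel Z] beta)
  (C4 : exists n : nat,
     (ereal_sup (range (fun z : borel Z =>
        'E_(Pr z)[fun w => (\prod_(t < n) beta (C t w))%R])) < 1)%E)
  (b : Y * Z -> R) (b_bm : bm b) (b_ge0 : forall x, 0 <= b x)
  (b_fix : upper_operator beta P Hbar rhi b = b) :
  let Vb := order_interval b in
  let Sig := feasible Gamma in
  let Trs := rs_operator r beta theta P H in
  [/\ fundamental_optimality Vb Sig Trs,
      VFI_converges Vb Sig Trs,
      OPI_converges Vb Sig Trs
    & HPI_converges Vb Sig Trs].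
Proof.
case: A1 => G_compact [G_uhc _]; case: A2 => _ _ r_cont.
case: C2 => Hbar_lub Hbar_meas Hbar_mono; case: C3 => _ beta_meas.
have beta_ge0 z : 0 <= beta z by exact: ltW.
(* The discount condition enters through geometric decay, which makes [b] increasing in the
   endogenous state. *)
case: C4 => n /(iter_discount_geometric C_chain beta_ge0 beta_meas)[rho rho01 bound].
have b_incr := b_mono beta_gt0 Hbar_meas Hbar_mono beta_meas b_bm b_ge0 b_fix
  rho01 bound.
exact: (risk_sensitive_optimality borel_prod A_sep A_metr Gamma_neq0 H_meas
  theta_lt0 beta_gt0 G_compact G_uhc r_cont A3 rlo_gt0 C1 Hbar_lub Hbar_meas
  beta_meas b_bm b_ge0 b_fix b_incr).
Qed.
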